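(* Let $G$ be a \{finitely generated free\}-by-cyclic group with polynomially growing monodromy. Then, for any cyclic subgroups $H,K\leq G$ and any $g\in G$, the double coset $HgK\subseteq G$ is separable in $G$.
   Context: A \{finitely generated free\}-by-cyclic group is a group $G$ with an epimorphism $\chi\colon G\to\mathbb{Z}$ whose kernel $F$ is free of finite rank; conjugation by an element $t\in\chi^{-1}(1)$ induces an automorphism of $F$ whose class $\Phi\in\mathrm{Out}(F)$ (independent of the choice of $t$) is called the monodromy. ''$G$ is \{finitely generated free\}-by-cyclic with monodromy having property P'' means that for some such $\chi$ the monodromy has property P. Growth: fix a free basis $X$ of $F$; for a conjugacy class $\bar g$ let $|\bar g|_X$ be the word length of a shortest representative. The class $\bar g$ grows polynomially of degree $d$ under $\Phi$ if there are constants $A,B>0$ with $Ak^d-A\leq|\Phi^k(\bar g)|_X\leq Bk^d$ for all $k\geq1$. $\Phi$ grows polynomially of degree $d$ if every conjugacy class grows polynomially of degree $\leq d$ and some class grows polynomially of degree exactly $d$; $\Phi$ is polynomially growing if this holds for some integer $d\geq0$. A subset $Y\subseteq G$ is separable if it is closed in the profinite topology; equivalently, for each $x\in G\setminus Y$ there is a homomorphism $\pi$ from $G$ onto a finite group with $\pi(x)\notin\pi(Y)$. *)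

(* Defs.v *)
From HB Require Import structures.
From mathcomp Require Import all_boot all_order all_algebra fingroup.
From mathcomp Require Import boolp classical_sets reals Rstruct.
From Stdlib Require Rdefinitions.

Set Implicit Arguments.
Unset Strict Implicit.
Unset Printing Implicit Defensive.

Import Order.TTheory GRing.Theory Num.Theory.

Local Open Scope classical_set_scope.
Local Open Scope group_scope.

Section Kernel.
Variables (G H : groupType) (f : {multiplicative G -> H}).

Definition in_ker : pred G := fun x => f x == 1.

Lemma mult_morph1 : f 1 = 1.
Proof. by apply: (mulgI (f 1)); rewrite -gmulfM !mulg1. Qed.

Lemma mult_morphV x : f x^-1 = (f x)^-1.
Proof. by apply: (mulgI (f x)); rewrite -gmulfM !mulgV mult_morph1. Qed.

Lemma ker_group_closed : group_closed in_ker.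
Proof.
split=> [|x y]; rewrite !unfold_in /in_ker; first by rewrite mult_morph1.
by move=> /eqP fx /eqP fy; rewrite gmulfM mult_morphV fx fy mulgV.
Qed.

Record kernel := Kernel { ker_val : G; ker_valP : in_ker ker_val }.

HB.instance Definition _ := [isSub for ker_val].
HB.instance Definition _ := [Choice of kernel by <:].
HB.instance Definition _ :=
  SubChoice_isSubGroup.Build G in_ker kernel ker_group_closed.

Lemma ker_conj_subproof (t : G) (x : kernel) : in_ker (t * val x * t^-1).
Proof.
by rewrite /in_ker !gmulfM (eqP (ker_valP x)) mulg1 mult_morphV mulgV.
Qed.

Definition ker_conj (t : G) (x : kernel) : kernel :=
  Kernel (ker_conj_subproof t x).

End Kernel.

Section FreeGroup.
Variables (F : groupType) (n : nat) (X : 'I_n -> F).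

(* The letter (i, b) stands for X i if b is true, and for (X i)^-1 otherwise *)
Definition word := seq ('I_n * bool).

Definition letter_val (l : 'I_n * bool) : F := if l.2 then X l.1 else (X l.1)^-1.

Definition word_val (w : word) : F := \prod_(l <- w) letter_val l.

Definition reduced (w : word) : bool :=
  sorted (fun l m : 'I_n * bool => m != (l.1, ~~ l.2)) w.

Definition free_basis : Prop :=
  forall g : F, exists! w : word, reduced w /\ word_val w = g.

Definition conj_class (g : F) : set F := [set g ^ h | h in [set: F]].

Definition class_length (C : set F) (m : nat) : Prop :=
  (exists2 w : word, C (word_val w) & size w = m) /\
  (forall w : word, C (word_val w) -> (m <= size w)%N).

(* An outer automorphism is given by a representative phi; as conjugacy classes
   are considered, the choice of the representative does not matter *)
Definition class_growth (phi : F -> F) (g : F) (d : nat) : Prop :=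
  exists A B : Rdefinitions.R, [/\ (0 < A)%R, (0 < B)%R &
    forall k : nat, (1 <= k)%N ->
      exists2 m : nat, class_length (conj_class (iter k phi g)) m &
        (A * k%:R ^+ d - A <= m%:R <= B * k%:R ^+ d)%R].

Definition growth_degree (phi : F -> F) (d : nat) : Prop :=
  (forall g : F, exists2 d' : nat, (d' <= d)%N & class_growth phi g d') /\
  (exists g : F, class_growth phi g d).

End FreeGroup.

Definition free_of_finite_rank (F : groupType) : Prop :=
  exists (n : nat) (X : 'I_n -> F), free_basis X.

(* The growth degree does not depend on the choice of the free basis *)
Definition polynomially_growing (F : groupType) (phi : F -> F) : Prop :=
  exists (n : nat) (X : 'I_n -> F),
    free_basis X /\ exists d : nat, growth_degree X phi d.

(* The infinite cyclic group, written multiplicatively *)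
Definition Zgroup : groupType := Algebra.to_multiplicative int.

Definition Zgen : Zgroup := 1%Z.

(* The automorphisms of the kernel induced by all t with chi t = 1 form a
   single coset of the inner automorphisms, i.e. one element of Out *)
Definition monodromy (G : groupType) (chi : {multiplicative G -> Zgroup}) :
    set (kernel chi -> kernel chi) :=
  [set ker_conj t | t in [set t : G | chi t = Zgen]].

Arguments monodromy {G} chi _.

Definition surjective (A B : Type) (f : A -> B) : Prop :=
  forall y : B, exists x : A, f x = y.

Definition fg_free_by_cyclic_with
    (P : forall F : groupType, (F -> F) -> Prop) (G : groupType) : Prop :=
  exists chi : {multiplicative G -> Zgroup},
    [/\ surjective chi, free_of_finite_rank (kernel chi) &
        exists2 phi, monodromy chi phi & P _ phi].

Definition cyclic_subgroup (G : groupType) (H : set G) : Prop :=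
  exists h : G, H = [set x | exists n : nat, x = h ^+ n \/ x = h ^- n].

Definition double_coset (G : groupType) (H : set G) (g : G) (K : set G) :
    set G :=
  [set h * g * k | h in H & k in K].

Definition separable (G : groupType) (Y : set G) : Prop :=
  forall x : G, ~ Y x ->
    exists (Q : finGroupType) (pi : {multiplicative G -> Q}),
      surjective pi /\ ~ (pi @` Y) (pi x).

(* Main.v *)
From HB Require Import structures.
Require Import Defs.
From mathcomp Require Import all_boot all_order all_algebra fingroup perm gproduct cyclic.
From mathcomp Require Import boolp classical_sets reals Rstruct.
From mathcomp Require Import zify ring.

(** Let [t] be an element of height 1 and let [psi] be the automorphism of the free
    kernel [F] that it induces.  Polynomial growth is used only for the action of [psi]
    on the homomorphisms from [F] to the integers: some power [psi^N] acts unipotently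
    there ([polynomial_growth_unipotent]).  Indeed, choose [N] such that the action [P]
    of [psi^N] is trivial modulo 4; then [(P - 1)^M] is divisible by [4^M], but being an
    [M]-th finite difference of a sequence of polynomial growth, it is bounded by [2^M]
    times a polynomial in [M], and so it vanishes for some [M].

    Let [G0] be the subgroup of finite index of elements whose height is divisible
    by [N].  The dimension subgroups of [F] form a filtration with trivial intersection
    and torsion-free abelian quotients, on which [psi^N] acts through tensor powers of
    its action on homomorphisms, again unipotently.  Hence [G0] is residually
    torsion-free nilpotent: the filtration can be refined to a chain of normal subgroups
    of [G0] in which each one is cut out of the previous one by a homomorphism [e] to the
    integers that is invariant under conjugation by [G0] ([level_chain],
    [levels_separated]).  Dimension subgroups are described by polynomial functions on
    [F], defined by iterated differences along the edges of the Cayley graph, which is a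
    tree.  A basis of these functions is given by the coefficients of the Magnus
    expansion, constructed as iterated sums along paths.  Modulo [q], the polynomial
    functions of a given degree form a finite set on which [G] acts, so that each [e] is
    detected modulo [q] by finite quotients of [G] ([polynomial_finite_kernel]).

    The rest is valid for every group with such a chain.  Separating [x] from the product
    of two cyclic subgroups amounts to the following: if [a^m x b^n <> 1] for all
    integers [m] and [n], then this persists in some finite quotient.  Along the chain,
    solutions in finite quotients are approximated by solutions modulo the members of
    the chain ([central_chain_approximation]), so it is enough to find a member modulo
    which there is no solution ([two_sided_excluded]).  The solutions modulo a member are
    a coset of the group of relations [(r, k)], those with [a^r b^k] in this member.
    These groups decrease and have torsion-free quotients in the plane lattice, so they
    are eventually constant ([isolated_subgroups_stabilise]).  From then on, the set of
    solutions modulo a member either stays the same or becomes empty, and it cannot stay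
    the same forever because the chain has trivial intersection. *)

Set Implicit Arguments.
Unset Strict Implicit.
Unset Printing Implicit Defensive.

Import Order.TTheory GRing.Theory Num.Theory.

Local Open Scope ring_scope.

(** * Integer powers and finite quotients *)

Section IntegerPowers.
Variable G : groupType.
Implicit Types (x y : G) (k l : int).

Definition zexpg x k : G :=
  match k with Posz n => (x ^+ n)%g | Negz n => (x ^- n.+1)%g end.

Lemma zexpgS x k : zexpg x (k + 1) = (zexpg x k * x)%g.
Proof.
case: k => n; first by rewrite -PoszD addn1 /zexpg expgSr.
case: n => [|n]; first by rewrite /= expg1 mulVg.
have ->: Negz n.+1 + 1 = Negz n by lia.
by rewrite /zexpg [(x ^+ n.+2)%g]expgS invgM mulgVK.
Qed.

Lemma zexpgB1 x k : zexpg x (k - 1) = (zexpg x k * x^-1)%g.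
Proof. by apply: (mulIg x); rewrite -zexpgS mulgVK subrK. Qed.

Lemma zexpgD x k l : zexpg x (k + l) = (zexpg x k * zexpg x l)%g.
Proof.
elim/int_rect: l => [|n IH|n IH]; first by rewrite addr0 mulg1.
  by rewrite intS [1 + _]addrC addrA !zexpgS IH mulgA.
by rewrite intS [1 + _]addrC opprD addrA !zexpgB1 IH mulgA.
Qed.

Lemma zexpgN x k : zexpg x (- k) = (zexpg x k)^-1%g.
Proof. by apply: (mulIg (zexpg x k)); rewrite -zexpgD addNr mulVg. Qed.

Lemma zexpgXn x (n : nat) k : zexpg (x ^+ n)%g k = zexpg x (n%:Z * k).
Proof.
case: k => m; first by rewrite -PoszM /zexpg expgnA.
by rewrite NegzE mulrN !zexpgN -PoszM /zexpg expgnA.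
Qed.

Lemma zexpgM x k l : zexpg x (k * l) = zexpg (zexpg x k) l.
Proof.
case: k => n; first by rewrite -zexpgXn.
have zV y m : zexpg y^-1%g m = zexpg y (- m).
  case: m => m; first by rewrite zexpgN /zexpg expVgn.
  by rewrite NegzE zexpgN opprK /zexpg expVgn invgK.
by rewrite /= zV zexpgXn NegzE mulrN mulNr.
Qed.

Lemma zexpgJ x y k : zexpg (x ^ y)%g k = (zexpg x k ^ y)%g.
Proof. by case: k => n; rewrite /zexpg -conjXg ?conjVg. Qed.

End IntegerPowers.

Lemma morph_zexpg (G H : groupType) (f : {multiplicative G -> H}) x k :
  f (zexpg x k) = zexpg (f x) k.
Proof.
have fX n : f (x ^+ n)%g = (f x ^+ n)%g.
  by elim: n => [|n IH]; rewrite ?mult_morph1 // !expgS gmulfM IH.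
by case: k => n; rewrite /zexpg ?mult_morphV fX.
Qed.

Section MorphismOf.
Variables (G H : magmaType) (f : G -> H).
Hypothesis fM : {morph f : x y / (x * y)%g}.

Definition morphism_of (_ : {morph f : x y / (x * y)%g}) := f.

HB.instance Definition _ :=
  isMultiplicative.Build G H (morphism_of fM) fM.

End MorphismOf.

Section FiniteQuotients.
Variable G : groupType.

(** Finite quotients enter through their kernels only, which are easy to intersect. *)
Definition finite_kernel (K : G -> Prop) : Prop :=
  exists (Q : finGroupType) (pi : {multiplicative G -> Q}),
    forall g, K g <-> pi g = 1%g.

Lemma finite_kernelM K x y : finite_kernel K -> K x -> K y -> K (x * y)%g.
Proof.
by case=> Q [pi piK] /piK x1 /piK y1; apply/piK; rewrite gmulfM x1 y1 mulg1.
Qed.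

Lemma finite_kernelT : finite_kernel (fun=> True).
Proof.
have oneM : {morph (fun _ : G => 1%g : {perm 'I_1}) : x y / (x * y)%g}.
  by move=> x y; rewrite mulg1.
by exists {perm 'I_1}, (morphism_of oneM).
Qed.

Lemma finite_kernelI K L :
  finite_kernel K -> finite_kernel L -> finite_kernel (fun g => K g /\ L g).
Proof.
case=> Q [pi piK] [R [rho rhoL]].
have pairM : {morph (fun g => (pi g, rho g)) : x y / (x * y)%g}.
  by move=> x y; rewrite !gmulfM.
exists (Q * R)%type, (morphism_of pairM) => g.
split=> [[/piK pg /rhoL rg]|]; first by rewrite /= /morphism_of pg rg.
by case=> /piK ? /rhoL.
Qed.

Lemma finite_kernel_all (T : eqType) (s : seq T) (K : T -> G -> Prop) :
  (forall i, i \in s -> finite_kernel (K i)) ->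
  exists2 L, finite_kernel L & forall i g, i \in s -> L g -> K i g.
Proof.
elim: s => [|i s IH] sK; first by exists (fun=> True); first exact: finite_kernelT.
have [j js|L fL LK] := IH; first by apply: sK; rewrite inE js orbT.
exists (fun g => K i g /\ L g).
  by apply: finite_kernelI fL; apply: sK; rewrite inE eqxx.
by move=> j g; rewrite inE => /predU1P[-> []//|js [_ /LK]]; apply.
Qed.

Lemma finite_kernel_exponent K : finite_kernel K ->
  exists2 e : nat, (0 < e)%N & forall g k, K (zexpg g (e%:Z * k)).
Proof.
case=> Q [pi piK]; exists #|[set: Q]|; first exact: cardG_gt0.
move=> g k; apply/piK; rewrite morph_zexpg zexpgM.
have -> : zexpg (pi g) #|[set: Q]| = 1%g.
  by apply: (@expg_cardG _ [set: Q]%G); rewrite inE.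
by case: k => n; rewrite /zexpg expg1n ?invg1.
Qed.

(** An action on a finite set is enough to get a finite quotient.  Permutations
    compose from left to right, hence the inverse in the proof. *)
Lemma finite_kernel_action (T : finType) (act : G -> T -> T) :
  (forall s, act 1%g s = s) ->
  (forall g h s, act (g * h)%g s = act g (act h s)) ->
  finite_kernel (fun g => forall s, act g s = s).
Proof.
move=> act1 actM.
have actK g : cancel (act g^-1%g) (act g) by move=> s; rewrite -actM mulgV act1.
pose pi g := perm (can_inj (actK g)).
have piM : {morph pi : g h / (g * h)%g}.
  by move=> g h; apply/permP=> s; rewrite permM !permE invgM actM.
exists {perm T}, (morphism_of piM) => g; split=> [gT|/permP g1 s].
  by apply/permP=> s; rewrite permE perm1 -[LHS]gT actK.
by rewrite -[in RHS](actK g s); move: (g1 s); rewrite permE perm1 => ->.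
Qed.

Lemma finite_kernel_surjective K : finite_kernel K ->
  exists (Q : finGroupType) (pi : {multiplicative G -> Q}),
    surjective pi /\ forall g, K g <-> pi g = 1%g.
Proof.
case=> Q [pi piK]; pose I := [set y | `[< exists x, pi x = y >]]%SET.
have inI y : reflect (exists x, pi x = y) (y \in I).
  by rewrite finset.in_set; apply: asboolP.
have Igroup : group_set I.
  apply/group_setP; split=> [|x y /inI[u ux] /inI[v vy]]; apply/inI.
    by exists 1%g; rewrite mult_morph1.
  by exists (u * v)%g; rewrite gmulfM ux vy.
pose H := Group Igroup.
have piH g : pi g \in H by apply/inI; exists g.
have subM : {morph (fun g => subg H (pi g)) : x y / (x * y)%g}.
  by move=> x y; rewrite gmulfM subgM.
exists (subg_of H), (morphism_of subM); split=> [[y Hy]|g].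
  have /inI[x xy] := Hy; exists x.
  by apply: val_inj; rewrite /= /morphism_of subgK xy.
rewrite piK; split=> [g1|/(congr1 (@sgval _ H))].
  by apply: val_inj; rewrite /= /morphism_of subgK g1.
by rewrite /= /morphism_of subgK.
Qed.

End FiniteQuotients.

(** * Central chains and two-sided equations *)

Section CentralChains.
Variables (G : groupType) (G0 : G -> Prop).

Record normalised_subgroup (N : G -> Prop) : Prop := NormalisedSubgroup {
  normalised1 : N 1%g;
  normalisedM : forall x y, N x -> N y -> N (x * y)%g;
  normalisedV : forall x, N x -> N x^-1%g;
  normalisedJ : forall g z, G0 g -> N z -> N (g * z * g^-1)%g }.

(** Invariance under conjugation makes the kernel of [e] on [N] normal in [G0] and
    [N] central modulo that kernel.  The last field says that the values of [e] are
    visible in finite quotients of the whole group. *)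
Record central_functional (N : G -> Prop) (e : G -> int) : Prop :=
  CentralFunctional {
  functionalM : forall x y, N x -> N y -> e (x * y)%g = e x + e y;
  functionalJ : forall g z, G0 g -> N z -> e (g * z * g^-1)%g = e z;
  functional_finite : forall q : nat, (0 < q)%N ->
    exists2 K, finite_kernel K & forall z, N z -> K z -> (q%:Z %| e z)%Z }.

Inductive central_chain (N : G -> Prop) : (G -> Prop) -> Prop :=
| CentralChain0 : central_chain N N
| CentralChainS N' e : central_chain N N' -> central_functional N' e ->
    central_chain N (fun z => N' z /\ e z = 0).

Lemma central_chain_trans N1 N2 N3 :
  central_chain N1 N2 -> central_chain N2 N3 -> central_chain N1 N3.
Proof. by move=> c12; elim=> // N' e _; apply: CentralChainS. Qed.

Lemma functional1 N e :
  normalised_subgroup N -> central_functional N e -> e 1%g = 0.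
Proof.
move=> [N1 _ _ _] [eM _ _]; apply: (addrI (e 1%g)).
by rewrite -eM // mulg1 addr0.
Qed.

Lemma functionalV N e x : normalised_subgroup N -> central_functional N e ->
  N x -> e x^-1%g = - e x.
Proof.
move=> nN ce Nx; apply: (addrI (e x)).
rewrite -(functionalM ce) //; last exact: (normalisedV nN).
by rewrite mulgV subrr (functional1 nN ce).
Qed.

Lemma normalised_functional_kernel N e :
  normalised_subgroup N -> central_functional N e ->
  normalised_subgroup (fun z => N z /\ e z = 0).
Proof.
move=> nN ce; split.
- by rewrite (functional1 nN ce); split=> //; apply: (normalised1 nN).
- move=> x y [Nx x0] [Ny y0]; split; first exact: (normalisedM nN).
  by rewrite (functionalM ce) // x0 y0.
- move=> x [Nx x0]; split; first exact: (normalisedV nN).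
  by rewrite (functionalV nN ce) // x0.
- move=> g z Gg [Nz z0]; split; first exact: (normalisedJ nN).
  by rewrite (functionalJ ce).
Qed.

Lemma central_chain_normalised N N' :
  normalised_subgroup N -> central_chain N N' -> normalised_subgroup N'.
Proof. by move=> nN; elim=> // N'' e _ nN''; apply: normalised_functional_kernel. Qed.

Section Products.
Variables a b : G.
Hypotheses (G0a : G0 a) (G0b : G0 b) (nG0 : normalised_subgroup G0).

(** The element [x] is in the product of the cyclic groups of [a] and [b] exactly if
    [two_sided x m n = 1] has a solution; the pairs with [two_sided 1 r k = 1] are the
    relations between powers of [a] and [b]. *)
Definition two_sided (x : G) (m n : int) : G := (zexpg a m * x * zexpg b n)%g.

Lemma G0_zexpg g k : G0 g -> G0 (zexpg g k).
Proof.
have G0X h n : G0 h -> G0 (h ^+ n)%g.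
  move=> Gh; elim: n => [|n IH]; first exact: (normalised1 nG0).
  by rewrite expgS; apply: (normalisedM nG0).
by case: k => n Gg; rewrite /zexpg; [|apply: (normalisedV nG0)]; apply: G0X.
Qed.

(** Moving a solution by a relation multiplies by the relation, up to a conjugation
    that central functionals do not see. *)
Lemma two_sidedD x m n r k :
  two_sided x (m + r) (n + k) =
  (zexpg a r * two_sided x m n * (zexpg a r)^-1 * two_sided 1 r k)%g.
Proof.
by rewrite /two_sided [m + r]addrC !zexpgD mulg1 !mulgA mulgVK.
Qed.

Section Normalised.
Variables (N : G -> Prop) (nN : normalised_subgroup N).

Lemma two_sided_shift x m n r k : N (two_sided x m n) ->
  N (two_sided x (m + r) (n + k)) <-> N (two_sided 1 r k).
Proof.
move=> Nmn; rewrite two_sidedD.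
set z := (_ * _^-1)%g; have Nz : N z by apply: (normalisedJ nN) => //; apply: G0_zexpg.
split=> [Nzw|]; last exact: (normalisedM nN).
by rewrite -[two_sided _ _ _](mulKg z); apply: (normalisedM nN) => //; apply: (normalisedV nN).
Qed.

Lemma two_sided00 : N (two_sided 1 0 0).
Proof. by rewrite /two_sided !mulg1; exact: (normalised1 nN). Qed.

Lemma relationsD r k r' k' : N (two_sided 1 r k) -> N (two_sided 1 r' k') ->
  N (two_sided 1 (r + r') (k + k')).
Proof. by move=> Nrk Nrk'; apply/(two_sided_shift r' k' Nrk). Qed.

Lemma relationsN r k : N (two_sided 1 r k) -> N (two_sided 1 (- r) (- k)).
Proof.
by move=> Nrk; apply/(two_sided_shift (- r) (- k) Nrk); rewrite !subrr; apply: two_sided00.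
Qed.

Lemma relationsM j r k : N (two_sided 1 r k) -> N (two_sided 1 (j * r) (j * k)).
Proof.
move=> Nrk; elim/int_rect: j => [|n IH|n IH].
- by rewrite !mul0r; apply: two_sided00.
- by rewrite intS !mulrDl !mul1r; apply: relationsD.
- by rewrite intS opprD !mulrDl !mulN1r; apply: relationsD; first apply: relationsN.
Qed.

Variables (e : G -> int) (ce : central_functional N e).

Lemma functional_shift x m n r k :
  N (two_sided x m n) -> N (two_sided 1 r k) ->
  e (two_sided x (m + r) (n + k)) = e (two_sided x m n) + e (two_sided 1 r k).
Proof.
move=> Nmn Nrk; have Ga := G0_zexpg r G0a.
rewrite two_sidedD (functionalM ce) //; last exact: (normalisedJ nN).
by rewrite (functionalJ ce).
Qed.

Lemma functional_relationsM j r k : N (two_sided 1 r k) ->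
  e (two_sided 1 (j * r) (j * k)) = j * e (two_sided 1 r k).
Proof.
move=> Nrk; have e0 : e (two_sided 1 0 0) = 0.
  by rewrite /two_sided !mulg1 (functional1 nN ce).
have eN : e (two_sided 1 (- r) (- k)) = - e (two_sided 1 r k).
  apply: (addrI (e (two_sided 1 r k))).
  by rewrite -functional_shift // ?subrr ?e0 //; apply: relationsN.
elim/int_rect: j => [|n IH|n IH]; first by rewrite !mul0r e0.
  rewrite intS !mulrDl !mul1r functional_shift ?IH //; exact: relationsM.
rewrite intS opprD !mulrDl !mulN1r functional_shift ?eN ?IH //.
  exact: relationsN.
exact: relationsM.
Qed.

End Normalised.

(** Each link of the chain cuts the group of relations down to the kernel of a
    homomorphism to the integers, so the quotient by it stays torsion-free. *)
Lemma relations_isolated N : central_chain G0 N -> forall j r k : int, j != 0 ->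
  N (two_sided 1 (j * r) (j * k)) -> N (two_sided 1 r k).
Proof.
elim=> [j r k _ _|N' e cN' IH ce j r k j0 [Njrk]].
  by rewrite /two_sided mulg1; apply: (normalisedM nG0); apply: G0_zexpg.
have nN' := central_chain_normalised nG0 cN'.
have Nrk := IH _ _ _ j0 Njrk.
rewrite (functional_relationsM nN' ce) // => /eqP; rewrite mulf_eq0 (negPf j0) /=.
by move/eqP.
Qed.

(** By induction along the chain.  For the next link, if [e] is nonzero on some
    relation [(r, k)], then a finite quotient that makes [e] divisible by
    [q * e (r, k)] at an approximate solution allows to correct it to [0] by a multiple
    of [q] times [(r, k)].  Otherwise [e] is constant on solutions, and one finite
    quotient decides whether this constant is [0].  In both cases the previous link is
    used with a modulus that also absorbs the exponent of the finite quotient. *)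
Lemma central_chain_approximation N x : G0 x -> central_chain G0 N ->
  forall q : nat, (0 < q)%N -> exists2 K, finite_kernel K &
    forall m n, K (two_sided x m n) ->
    exists i j : int, N (two_sided x (m + q%:Z * i) (n + q%:Z * j)).
Proof.
move=> G0x; elim=> [q q0|N' e cN' IH ce q q0].
  exists (fun=> True); first exact: finite_kernelT.
  move=> m n _; exists 0, 0; rewrite !mulr0 !addr0.
  by apply: (normalisedM nG0); [apply: (normalisedM nG0) => //|]; apply: G0_zexpg.
have nN' := central_chain_normalised nG0 cN'.
have [[r [k [Nrk erk0]]]|const] :=
  pselect (exists r k, N' (two_sided 1 r k) /\ e (two_sided 1 r k) != 0).
- have qd0 : (0 < q * `|e (two_sided 1 r k)|)%N by rewrite muln_gt0 q0 absz_gt0.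
  have [K fK Ke] := functional_finite ce qd0.
  have [c c0 Kc] := finite_kernel_exponent fK.
  have qc0 : (0 < q * c)%N by rewrite muln_gt0 q0.
  have [L fL LN] := IH _ qc0.
  exists (fun g => K g /\ L g); first exact: finite_kernelI.
  move=> m n [Kmn /LN[i [j]]].
  set m' := m + _; set n' := n + _ => Nmn'.
  have Kmn' : K (two_sided x m' n').
    have -> : two_sided x m' n' =
        (zexpg a (c%:Z * (q%:Z * i)) * two_sided x m n * zexpg b (c%:Z * (q%:Z * j)))%g.
      rewrite /two_sided !mulgA -!zexpgD -!mulgA -!zexpgD.
      by congr (zexpg _ _ * (_ * zexpg _ _))%g; rewrite /m' /n' PoszM; ring.
    by apply: finite_kernelM => //; apply: finite_kernelM.
  have /dvdzP[w ew] := Ke _ Nmn' Kmn'.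
  pose s := - sgz (e (two_sided 1 r k)) * w * q%:Z.
  exists (c%:Z * i - sgz (e (two_sided 1 r k)) * w * r).
  exists (c%:Z * j - sgz (e (two_sided 1 r k)) * w * k).
  have -> : m + q%:Z * (c%:Z * i - sgz (e (two_sided 1 r k)) * w * r) = m' + s * r.
    by rewrite /m' /s PoszM; ring.
  have -> : n + q%:Z * (c%:Z * j - sgz (e (two_sided 1 r k)) * w * k) = n' + s * k.
    by rewrite /n' /s PoszM; ring.
  have Nsrk := relationsM nN' s Nrk.
  split; first by apply/(two_sided_shift nN' (s * r) (s * k) Nmn').
  rewrite (functional_shift nN' ce) // (functional_relationsM nN' ce) // ew /s.
  rewrite PoszM; set d := e _; have -> : `|d|%N%:Z = sgz d * d by rewrite abszEsg.
  by ring.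
- have eqe m n m' n' : N' (two_sided x m n) -> N' (two_sided x m' n') ->
      e (two_sided x m' n') = e (two_sided x m n).
    move=> Nmn Nmn'; have -> : m' = m + (m' - m) by ring.
    have -> : n' = n + (n' - n) by ring.
    have Nd : N' (two_sided 1 (m' - m) (n' - n)).
      apply/(two_sided_shift nN' (m' - m) (n' - n) Nmn).
      by rewrite ![_ + (_ - _)]addrC !subrK.
    rewrite (functional_shift nN' ce) //.
    suff -> : e (two_sided 1 (m' - m) (n' - n)) = 0 by rewrite addr0.
    by apply/eqP/negPn/negP => ne; apply: const; exists (m' - m), (n' - n).
  have [c c0 cN] : exists2 c : nat, (0 < c)%N &
      forall m n, N' (two_sided x m n) -> (c%:Z %| e (two_sided x m n))%Z ->
      e (two_sided x m n) = 0.
    have [[m [n Nmn]]|noN] := pselect (exists m n, N' (two_sided x m n)); last first.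
      by exists 1%N => // m n Nmn; case: noN; exists m, n.
    exists `|e (two_sided x m n)|.+1 => // m' n' Nmn'; rewrite (eqe m n) // => dv.
    apply/eqP/negPn/negP => e0; have := dvdn_leq _ dv.
    by rewrite absz_gt0 => /(_ e0); rewrite ltnn.
  have [K fK Ke] := functional_finite ce c0.
  have [f f0 Kf] := finite_kernel_exponent fK.
  have qf0 : (0 < q * f)%N by rewrite muln_gt0 q0.
  have [L fL LN] := IH _ qf0.
  exists (fun g => K g /\ L g); first exact: finite_kernelI.
  move=> m n [Kmn /LN[i [j Nmn']]]; exists (f%:Z * i), (f%:Z * j).
  rewrite !mulrA -!PoszM; split=> //; apply: cN => //; apply: Ke => //.
  have -> : two_sided x (m + (q * f)%N%:Z * i) (n + (q * f)%N%:Z * j) =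
      (zexpg a (f%:Z * (q%:Z * i)) * two_sided x m n * zexpg b (f%:Z * (q%:Z * j)))%g.
    rewrite /two_sided !mulgA -!zexpgD -!mulgA -!zexpgD.
    by congr (zexpg _ _ * (_ * zexpg _ _))%g; rewrite PoszM; ring.
  by apply: finite_kernelM => //; apply: finite_kernelM.
Qed.

End Products.
End CentralChains.

(** In a decreasing sequence of subgroups of the plane lattice with torsion-free
    quotients, the rank drops at most twice, and two nested such subgroups of the same
    rank are equal. *)
Lemma isolated_subgroups_stabilise (L : nat -> int -> int -> Prop) :
  (forall c, L c 0 0) ->
  (forall c r k r' k', L c r k -> L c r' k' -> L c (r + r') (k + k')) ->
  (forall c j r k, L c r k -> L c (j * r) (j * k)) ->
  (forall c j r k, j != 0 -> L c (j * r) (j * k) -> L c r k) ->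
  (forall c d r k, (c <= d)%N -> L d r k -> L c r k) ->
  exists c, forall d, (c <= d)%N -> forall r k, L c r k -> L d r k.
Proof.
move=> L0 LD LM Lisolated Ldec.
have [[c Lc0]|L_nontrivial] :=
  pselect (exists c, forall r k, L c r k -> r = 0 /\ k = 0).
  by exists c => d _ r k /Lc0[-> ->].
have [[c Lc1]|L_rank2] := pselect (exists c, forall r k r' k',
    L c r k -> L c r' k' -> r * k' = k * r').
  exists c => d cd r k Lrk.
  have [[u [v [Luv uv0]]]|no_uv] :=
    pselect (exists u v, L d u v /\ ((u != 0) || (v != 0))); last first.
    case: L_nontrivial; exists d => u v Luv.
    have [uv0|] := boolP ((u != 0) || (v != 0)); first by case: no_uv; exists u, v.
    by rewrite negb_or !negbK => /andP[/eqP-> /eqP->].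
  have rv := Lc1 _ _ _ _ Lrk (Ldec _ _ _ _ cd Luv).
  case/orP: uv0 => [u0|v0].
    by apply: (Lisolated _ u) => //; rewrite [u * k]mulrC -rv [u * r]mulrC; apply: LM.
  by apply: (Lisolated _ v) => //; rewrite [v * r]mulrC rv [v * k]mulrC; apply: LM.
exists 0%N => d _ p q _.
have [[r [k [r' [k' [Lrk Lrk' det0]]]]]|no_basis] := pselect (exists r k r' k',
    [/\ L d r k, L d r' k' & r * k' - k * r' != 0]); last first.
  case: L_rank2; exists d => r k r' k' Lrk Lrk'; apply/eqP; rewrite -subr_eq0.
  by apply/negPn/negP => det0; apply: no_basis; exists r, k, r', k'.
apply: (Lisolated _ (r * k' - k * r')) => //.
have -> : (r * k' - k * r') * p = (p * k' - q * r') * r + (q * r - p * k) * r' by ring.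
have -> : (r * k' - k * r') * q = (p * k' - q * r') * k + (q * r - p * k) * k' by ring.
by apply: LD; apply: LM.
Qed.

Section ResiduallyCentral.
Variables (G : groupType) (G0 : G -> Prop) (V : nat -> G -> Prop).
Hypothesis nG0 : normalised_subgroup G0 G0.
Hypothesis cV : forall c, central_chain G0 G0 (V c).
Hypothesis V_dec : forall c d g, (c <= d)%N -> V d g -> V c g.
Hypothesis V_separated : forall g, (forall c, V c g) -> g = 1%g.

(** If no level excluded all solutions, pick a level [c] after which the relations
    do not change any more, and a solution modulo that level.  It fails to be a
    solution at some deeper level [d]; but a solution at level [d] differs from it
    by a relation at level [c], which is a relation at level [d]. *)
Lemma two_sided_excluded a b x : G0 a -> G0 b -> G0 x ->
  (forall m n, two_sided a b x m n <> 1%g) ->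
  exists c, forall m n, ~ V c (two_sided a b x m n).
Proof.
move=> Ga Gb Gx no_sol.
have nV c : normalised_subgroup G0 (V c) := central_chain_normalised nG0 (cV c).
have [|||||c stable] :=
    @isolated_subgroups_stabilise (fun c r k => V c (two_sided a b 1%g r k)).
- by move=> c; apply: (two_sided00 _ _ (nV c)).
- by move=> c r k r' k' /=; apply: (relationsD Ga nG0 (nV c)).
- by move=> c j r k /=; apply: (relationsM Ga nG0 (nV c)).
- by move=> c j r k /=; apply: (relations_isolated Ga Gb nG0 (cV c)).
- by move=> c d r k /=; apply: V_dec.
have [[m [n Vmn]]|no_sol_c] := pselect (exists m n, V c (two_sided a b x m n));
  last by exists c => m n Vmn; apply: no_sol_c; exists m, n.
have [d Vd] : exists d, ~ V d (two_sided a b x m n).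
  by apply: contrapT => Vd; apply: (no_sol m n); apply: V_separated => d;
     apply: contrapT => nVd; apply: Vd; exists d.
have cd : (c <= d)%N.
  by case: leqP => // dc; case: Vd; apply: V_dec Vmn; apply: ltnW.
exists d => m' n' Vmn'; apply: Vd.
have shift e : V e (two_sided a b x m' n') ->
    V e (two_sided a b x m n) <-> V e (two_sided a b 1 (m - m') (n - n')).
  move=> Ve; have := two_sided_shift Ga nG0 (nV e) (m - m') (n - n') Ve.
  by rewrite ![_ + (_ - _)]addrC !subrK.
by apply/(shift _ Vmn')/(stable _ cd)/(shift _ (V_dec cd Vmn')).
Qed.

(** The modulus [1] suffices here: at a level without solutions there is nothing to
    approximate. *)
Lemma two_sided_separated_in a b x : G0 a -> G0 b -> G0 x ->
  (forall m n, two_sided a b x m n <> 1%g) ->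
  exists2 K : G -> Prop, finite_kernel K & forall m n, ~ K (two_sided a b x m n).
Proof.
move=> Ga Gb Gx /(two_sided_excluded Ga Gb Gx)[c no_sol].
have [K fK KV] := central_chain_approximation Ga Gb nG0 Gx (cV c) (ltnSn 0).
by exists K => // m n /KV[i [j /no_sol]].
Qed.

(** Powers of [a] and [b] lie in [G0], so that the product of the cyclic groups of
    [a] and [b] is a finite union of translates of products as above. *)
Lemma two_sided_separated (K0 : G -> Prop) (a b x : G) :
  finite_kernel K0 -> (forall g, K0 g -> G0 g) ->
  (forall m n, two_sided a b x m n <> 1%g) ->
  exists2 K : G -> Prop, finite_kernel K & forall m n, ~ K (two_sided a b x m n).
Proof.
move=> fK0 K0G no_sol; have [e e0 K0e] := finite_kernel_exponent fK0.
have e_neq0 : e%:Z != 0 by rewrite eqz_nat -lt0n.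
have GX g : G0 (g ^+ e)%g by apply: K0G; have := K0e g 1; rewrite mulr1.
pose y (ij : 'I_e * 'I_e) := two_sided a b x ij.1%:Z ij.2%:Z.
have yE ij m n : two_sided (a ^+ e)%g (b ^+ e)%g (y ij) m n =
    two_sided a b x (e%:Z * m + ij.1%:Z) (e%:Z * n + ij.2%:Z).
  rewrite /y /two_sided !zexpgXn !zexpgD !mulgA -!mulgA.
  by rewrite -!zexpgD [_ + e%:Z * n]addrC.
have sep ij : exists K, finite_kernel K /\
    forall m n, ~ K (two_sided (a ^+ e)%g (b ^+ e)%g (y ij) m n).
  have [Gy|nGy] := pselect (G0 (y ij)).
    have [|K fK K_sep] := two_sided_separated_in (GX a) (GX b) Gy; last by exists K.
    by move=> m n; rewrite yE; apply: no_sol.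
  exists K0; split=> // m n /K0G Gamn; apply: nGy.
  have -> : y ij = ((zexpg (a ^+ e) m)^-1 *
      two_sided (a ^+ e) (b ^+ e) (y ij) m n * (zexpg (b ^+ e) n)^-1)%g.
    by rewrite /two_sided !mulgA mulVg mul1g mulgK.
  have GXV g l : G0 (zexpg (g ^+ e) l)^-1%g.
    exact/(normalisedV nG0)/(G0_zexpg nG0)/GX.
  by apply: (normalisedM nG0) => //; apply: (normalisedM nG0).
have [K K_sep] := choice sep.
have [|L fL LK] := @finite_kernel_all _ _ (enum {: 'I_e * 'I_e}) K.
  by move=> ij _; case: (K_sep ij).
exists L => // m n Lmn.
have modP k : exists i : 'I_e, k = e%:Z * (k %/ e%:Z)%Z + i%:Z.
  have r0 := modz_ge0 k e_neq0; have re := ltz_pmod k (e0 : 0 < e%:Z).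
  have ri : (`|(k %% e%:Z)%Z| < e)%N by rewrite -ltz_nat gez0_abs.
  by exists (Ordinal ri); rewrite /= gez0_abs // mulrC -divz_eq.
have [i mi] := modP m; have [j nj] := modP n.
have [_ /(_ (m %/ e%:Z)%Z (n %/ e%:Z)%Z)] := K_sep (i, j); apply.
by rewrite yE -mi -nj; apply: LK => //; rewrite mem_enum.
Qed.

End ResiduallyCentral.

(** * Double cosets of cyclic subgroups *)

Lemma separable_double_coset (G : groupType) :
  (forall a b x : G, (forall m n, two_sided a b x m n <> 1%g) ->
     exists2 K : G -> Prop, finite_kernel K & forall m n, ~ K (two_sided a b x m n)) ->
  forall (H K : set G) (g : G), cyclic_subgroup H -> cyclic_subgroup K ->
  separable (double_coset H g K).
Proof.
move=> sep _ _ g [h ->] [k ->] x xHK.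
have zexpg_cyclic y z :
    (exists n : nat, z = (y ^+ n)%g \/ z = (y ^- n)%g) <-> exists m, z = zexpg y m.
  split=> [[n [->|->]]|[[] n ->]].
  - by exists n%:Z.
  - by exists (- n%:Z); rewrite zexpgN.
  - by exists n; left.
  - by exists n.+1; right.
have two_sidedE m n : two_sided (h ^ x)%g k (x^-1 * g)%g m n =
    (x^-1 * (zexpg h m * g * zexpg k n))%g.
  by rewrite /two_sided zexpgJ /conjg !mulgA mulgK.
have [|K fK K_sep] := sep (h ^ x)%g k (x^-1 * g)%g.
  move=> m n; rewrite two_sidedE => /eqP; rewrite mulg_eq1 eqg_inv => /eqP xE.
  apply: xHK; exists (zexpg h m); first by apply/zexpg_cyclic; exists m.
  by exists (zexpg k n); first by apply/zexpg_cyclic; exists n.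
have [Q [pi [pi_surj piK]]] := finite_kernel_surjective fK.
exists Q, pi; split=> // -[_ [_ /zexpg_cyclic[m ->] [_ /zexpg_cyclic[n ->] <-]]] pix.
apply: (K_sep m n); apply/piK; rewrite two_sidedE gmulfM pix -gmulfM mulVg.
exact: mult_morph1.
Qed.

(** * Integration on the Cayley tree of a free group *)

Section FreeGroup.
Variables (F : groupType) (n : nat) (X : 'I_n -> F).
Hypothesis X_basis : free_basis X.

Implicit Types (g u : F) (w : word n) (j : 'I_n).

Definition inverse_letter (l : 'I_n * bool) := (l.1, ~~ l.2).

Lemma word_val_rcons w l : word_val X (rcons w l) = (word_val X w * letter_val X l)%g.
Proof. by rewrite /word_val big_rcons. Qed.

Lemma letter_val_inverse l : (letter_val X l * letter_val X (inverse_letter l) = 1)%g.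
Proof. by case: l => j [] /=; rewrite /letter_val /= ?mulgV ?mulVg. Qed.

Lemma reduced_word w : exists w', [/\ reduced w', word_val X w' = word_val X w &
  forall (T : Type) (step : T -> 'I_n * bool -> T),
    (forall s l, step (step s l) (inverse_letter l) = s) ->
    forall s, foldl step s w' = foldl step s w].
Proof.
elim: w => [|l w [w' [w'_red w'E w'_step]]]; first by exists [::].
have [|l_red] := boolP (reduced (l :: w')); last first.
  case: w' => [|m w''] in w'_red w'E w'_step l_red *; first by case/negP: l_red.
  have ml : m = inverse_letter l.
    apply/eqP/negPn/negP => ml; case/negP: l_red.
    by rewrite /reduced /= in w'_red *; rewrite w'_red andbT.
  exists w''; split=> [||T step stepK s].
  - by move: w'_red; rewrite /reduced; case: (w'') => //= ? ? /andP[].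
  - rewrite /word_val big_cons -[\big[_/_]_(_ <- w) _]/(word_val X w) -w'E.
    by rewrite /word_val big_cons mulgA ml letter_val_inverse mul1g.
  - by rewrite /= -w'_step //= ml stepK.
exists (l :: w'); split=> // [|T step stepK s]; last by rewrite /= w'_step.
by rewrite /word_val !big_cons; congr (_ * _)%g.
Qed.

(** The Cayley graph of [F] is a tree: a computation along a walk that backtracking
    undoes depends on the end point of the walk only. *)
Lemma foldl_word_val (T : Type) (step : T -> 'I_n * bool -> T) w1 w2 s :
  (forall s l, step (step s l) (inverse_letter l) = s) ->
  word_val X w1 = word_val X w2 -> foldl step s w1 = foldl step s w2.
Proof.
move=> stepK w12; have [w1' [red1 val1 <-//]] := reduced_word w1.
have [w2' [red2 val2 <-//]] := reduced_word w2.
have [w [_ w_uniq]] := X_basis (word_val X w1).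
by rewrite -(w_uniq w1') // (w_uniq w2') // val2.
Qed.

Lemma word_of_subproof g : exists w, word_val X w = g.
Proof. by have [w [[_ <-] _]] := X_basis g; exists w. Qed.

Definition word_of g : word n := sval (cid (word_of_subproof g)).

Lemma word_ofK g : word_val X (word_of g) = g.
Proof. exact: (svalP (cid (word_of_subproof g))). Qed.

Lemma free_group_ind (P : F -> Prop) : P 1%g ->
  (forall g j, P g -> P (g * X j)%g) ->
  (forall g j, P g -> P (g * (X j)^-1)%g) -> forall g, P g.
Proof.
move=> P1 PX PV g; rewrite -[g]word_ofK; move: (word_of g) => w.
elim/last_ind: w => [|w [j []] IH]; first by rewrite /word_val big_nil.
  by rewrite word_val_rcons; apply: PX.
by rewrite word_val_rcons; apply: PV.
Qed.

Section Integral.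
Variables (A : zmodType) (theta : 'I_n -> F -> A).

Definition integral_step (s : F * A) (l : 'I_n * bool) : F * A :=
  let g := (s.1 * letter_val X l)%g in
  (g, if l.2 then s.2 + theta l.1 s.1 else s.2 - theta l.1 g).

(** On a tree every cochain is a coboundary: [integral theta] is the function vanishing
    at [1] with prescribed increments [theta] along the edges. *)
Definition integral g : A := (foldl integral_step (1%g, 0) (word_of g)).2.

Lemma integral_stepK s l : integral_step (integral_step s l) (inverse_letter l) = s.
Proof.
case: s l => g a [j b]; rewrite /integral_step /= -mulgA letter_val_inverse mulg1.
by case: b; rewrite /= ?addrK ?subrK.
Qed.

Lemma integral_word w : foldl integral_step (1%g, 0) w = (word_val X w, integral (word_val X w)).
Proof.
rewrite (@foldl_word_val _ _ _ (word_of (word_val X w)) _ integral_stepK) ?word_ofK //.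
rewrite [LHS]surjective_pairing; congr pair.
rewrite -[in RHS](word_ofK (word_val X w)); move: (word_of _) => w'.
elim/last_ind: w' => [|w' l IH]; first by rewrite /word_val big_nil.
by rewrite foldl_rcons /= IH word_val_rcons.
Qed.

Lemma integral1 : integral 1%g = 0.
Proof. by have := integral_word [::]; rewrite /word_val big_nil => -[]. Qed.

Lemma integralX g j : integral (g * X j)%g = integral g + theta j g.
Proof.
have := integral_word (rcons (word_of g) (j, true)).
by rewrite foldl_rcons integral_word word_val_rcons word_ofK => -[].
Qed.

End Integral.

(** * Polynomial functions on a free group *)

Section PolynomialFunctions.

Definition rdiff (A : zmodType) j (phi : F -> A) : F -> A :=
  fun g => phi (g * X j)%g - phi g.

Lemma rdiff_integral (A : zmodType) (theta : 'I_n -> F -> A) j :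
  rdiff j (integral theta) = theta j.
Proof. by apply/funext => g; rewrite /rdiff integralX [_ + theta _ _]addrC addrK. Qed.

Lemma rdiff0_const (A : zmodType) (phi : F -> A) :
  (forall j g, rdiff j phi g = 0) -> forall g, phi g = phi 1%g.
Proof.
move=> phi0; have phiX g j : phi (g * X j)%g = phi g by apply/subr0_eq/phi0.
by apply: free_group_ind => // g j <-; rewrite // -(phiX _ j) mulgVK.
Qed.

Lemma eq_from_rdiff (A : zmodType) (phi psi : F -> A) : phi 1%g = psi 1%g ->
  (forall j g, rdiff j phi g = rdiff j psi g) -> phi = psi.
Proof.
move=> eq1 eqd; apply/funext => g; apply/subr0_eq.
rewrite (@rdiff0_const _ (fun g => phi g - psi g)) ?eq1 ?subrr // => j g'.
by rewrite /rdiff opprD addrACA -opprD; have := eqd j g'; rewrite /rdiff => ->; rewrite subrr.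
Qed.

(** Polynomial functions of degree less than [c].  Starting at the zero function
    rather than at constants makes the difference lemmas hold for every [c]. *)
Fixpoint polynomial_fun (A : zmodType) (c : nat) (phi : F -> A) : Prop :=
  if c is c'.+1 then forall j, polynomial_fun c' (rdiff j phi) else forall g, phi g = 0.

Lemma polynomial0 (A : zmodType) c : polynomial_fun c (fun=> 0 : A).
Proof.
elim: c => //= c IH j; rewrite (_ : rdiff _ _ = fun=> 0) //.
by apply/funext => g; rewrite /rdiff subrr.
Qed.

Lemma polynomialD (A : zmodType) c (phi psi : F -> A) :
  polynomial_fun c phi -> polynomial_fun c psi -> polynomial_fun c (fun g => phi g + psi g).
Proof.
elim: c phi psi => /= [phi psi phi0 psi0 g|c IH phi psi Pphi Ppsi j].
  by rewrite phi0 psi0 addr0.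
rewrite (_ : rdiff _ _ = fun g => rdiff j phi g + rdiff j psi g); first exact: IH.
by apply/funext => g; rewrite /rdiff opprD addrACA.
Qed.

Lemma polynomial_additive (A B : zmodType) (f : A -> B) c (phi : F -> A) :
  {morph f : x y / x - y} -> polynomial_fun c phi -> polynomial_fun c (fun g => f (phi g)).
Proof.
move=> fB; elim: c phi => /= [phi phi0 g|c IH phi Pphi j].
  by rewrite phi0 -[0](subrr 0) fB subrr.
rewrite (_ : rdiff _ _ = fun g => f (rdiff j phi g)); first exact: IH.
by apply/funext => g; rewrite /rdiff fB.
Qed.

Lemma polynomialB (A : zmodType) c (phi psi : F -> A) :
  polynomial_fun c phi -> polynomial_fun c psi -> polynomial_fun c (fun g => phi g - psi g).
Proof.
move=> Pphi Ppsi; apply: polynomialD => //.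
by apply: (@polynomial_additive _ _ -%R) => // x y; rewrite opprD.
Qed.

Lemma polynomialZ c (k : int) (phi : F -> int) :
  polynomial_fun c phi -> polynomial_fun c (fun g => k * phi g).
Proof. by apply: polynomial_additive => x y; rewrite mulrBr. Qed.

Lemma polynomialS (A : zmodType) c (phi : F -> A) :
  polynomial_fun c phi -> polynomial_fun c.+1 phi.
Proof.
elim: c phi => [phi phi0 j g|c IH phi Pphi j]; last exact: IH.
by rewrite /rdiff !phi0 subrr.
Qed.

Lemma polynomial_leq (A : zmodType) c d (phi : F -> A) :
  (c <= d)%N -> polynomial_fun c phi -> polynomial_fun d phi.
Proof.
move/subnK <-; elim: (d - c)%N => // m IH Pphi.
by rewrite addSn; apply/polynomialS/IH.
Qed.

Lemma polynomial1_const (A : zmodType) (phi : F -> A) g :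
  polynomial_fun 1 phi -> phi g = phi 1%g.
Proof. by move=> Pphi; apply: rdiff0_const. Qed.

Lemma polynomial_ltrans (A : zmodType) c (phi : F -> A) h :
  polynomial_fun c phi -> polynomial_fun c (fun g => phi (h * g)%g).
Proof.
elim: c phi => /= [phi phi0 g|c IH phi Pphi j]; first by rewrite phi0.
rewrite (_ : rdiff _ _ = fun g => rdiff j phi (h * g)%g); first exact: IH.
by apply/funext => g; rewrite /rdiff mulgA.
Qed.

Lemma polynomial_ldiff (A : zmodType) c (phi : F -> A) h :
  polynomial_fun c.+1 phi -> polynomial_fun c (fun g => phi (h * g)%g - phi g).
Proof.
elim: c phi => [phi Pphi g|c IH phi Pphi j].
  by rewrite polynomial1_const // [phi g]polynomial1_const // subrr.
rewrite (_ : rdiff _ _ = fun g => rdiff j phi (h * g)%g - rdiff j phi g).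
  exact/IH/Pphi.
by apply/funext => g; rewrite /rdiff mulgA !opprD addrACA.
Qed.

(** Differences along generators control those along all elements; translations and
    differences have to be treated together. *)
Lemma polynomial_rtrans_rdiff (A : zmodType) c :
  (forall (phi : F -> A) u, polynomial_fun c phi -> polynomial_fun c (fun g => phi (g * u)%g)) /\
  (forall (phi : F -> A) u,
     polynomial_fun c.+1 phi -> polynomial_fun c (fun g => phi (g * u)%g - phi g)).
Proof.
have from_rtrans c' :
    (forall (phi : F -> A) u, polynomial_fun c' phi -> polynomial_fun c' (fun g => phi (g * u)%g)) ->
    forall (phi : F -> A) u,
    polynomial_fun c'.+1 phi -> polynomial_fun c' (fun g => phi (g * u)%g - phi g).
  move=> rtrans phi u Pphi; elim/free_group_ind: u => [|u j IH|u j IH].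
  - rewrite (_ : (fun g => _) = fun=> 0); first exact: polynomial0.
    by apply/funext => g; rewrite mulg1 subrr.
  - rewrite (_ : (fun g => _) = fun g =>
      rdiff j phi (g * u)%g + (phi (g * u)%g - phi g)).
      by apply: polynomialD => //; apply/rtrans/Pphi.
    by apply/funext => g; rewrite /rdiff mulgA addrA subrK.
  - rewrite (_ : (fun g => _) = fun g =>
      (phi (g * u)%g - phi g) - rdiff j phi (g * (u * (X j)^-1))%g).
      by apply: polynomialB => //; apply/rtrans/Pphi.
    apply/funext => g; rewrite /rdiff !mulgA mulgVK.
    by rewrite opprB [RHS]addrC addrA subrK.
have rtrans : forall (phi : F -> A) u,
    polynomial_fun c phi -> polynomial_fun c (fun g => phi (g * u)%g).
  elim: c => [phi u phi0 g|c IH phi u Pphi]; first by rewrite phi0.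
  rewrite (_ : (fun g => _) = fun g => phi g + (phi (g * u)%g - phi g)).
    by apply: polynomialD => //; apply: polynomialS; apply: from_rtrans.
  by apply/funext => g; rewrite addrC subrK.
by split=> //; apply: from_rtrans.
Qed.

Lemma polynomial_rtrans (A : zmodType) c (phi : F -> A) u :
  polynomial_fun c phi -> polynomial_fun c (fun g => phi (g * u)%g).
Proof. by case: (polynomial_rtrans_rdiff A c) => + _; apply. Qed.

Lemma polynomial_rdiff (A : zmodType) c (phi : F -> A) u :
  polynomial_fun c.+1 phi -> polynomial_fun c (fun g => phi (g * u)%g - phi g).
Proof. by case: (polynomial_rtrans_rdiff A c) => _; apply. Qed.

(** The reason to work with polynomial functions: their definition by differences
    along generators is in fact independent of the basis. *)
Lemma polynomial_endomorphism (A : zmodType) c (phi : F -> A) (al : F -> F) :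
  {morph al : x y / (x * y)%g} ->
  polynomial_fun c phi -> polynomial_fun c (fun g => phi (al g)).
Proof.
move=> alM; elim: c phi => [phi phi0 g|c IH phi Pphi j]; first by rewrite phi0.
pose psi g := phi (g * al (X j))%g - phi g.
rewrite (_ : rdiff _ _ = fun g => psi (al g)); first exact/IH/polynomial_rdiff.
by apply/funext => g; rewrite /rdiff alM.
Qed.

End PolynomialFunctions.

(** * Iterated sums and the Magnus expansion *)

Section IteratedSums.

Definition letter := {ffun 'I_n -> int}.
Implicit Types (h : letter) (l : seq letter) (al : F -> F).

(** The coefficients of the Magnus expansion, in coordinates: the iterated sums along
    the path from [1] to [g] in the Cayley graph of the cochains given by [l], the
    head of [l] being the last one. *)
Fixpoint iterated_sum l : F -> int :=
  if l is h :: l' then integral (fun j g => h j * iterated_sum l' g) else fun=> 1.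

Lemma iterated_sum1 h l : iterated_sum (h :: l) 1%g = 0.
Proof. exact: integral1. Qed.

Lemma iterated_sumX h l g j :
  iterated_sum (h :: l) (g * X j)%g = iterated_sum (h :: l) g + h j * iterated_sum l g.
Proof. exact: integralX. Qed.

Lemma iterated_sumXV h l g j : iterated_sum (h :: l) (g * (X j)^-1)%g =
  iterated_sum (h :: l) g - h j * iterated_sum l (g * (X j)^-1)%g.
Proof.
apply: (addIr (h j * iterated_sum l (g * (X j)^-1)%g)).
by rewrite -iterated_sumX mulgVK subrK.
Qed.

Lemma rdiff_iterated_sum h l j :
  rdiff j (iterated_sum (h :: l)) = fun g => h j * iterated_sum l g.
Proof. exact: rdiff_integral. Qed.

Lemma iterated_sum_polynomial l : polynomial_fun (size l).+1 (iterated_sum l).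
Proof.
elim: l => [|h l IH] j; first by move=> g; rewrite /rdiff subrr.
by rewrite rdiff_iterated_sum; exact: (polynomialZ (h j) IH).
Qed.

Definition hom_of_letter h : F -> int := iterated_sum [:: h].

Lemma hom_of_letterX h g j : hom_of_letter h (g * X j)%g = hom_of_letter h g + h j.
Proof. by rewrite /hom_of_letter iterated_sumX mulr1. Qed.

Lemma hom_of_letterXV h g j : hom_of_letter h (g * (X j)^-1)%g = hom_of_letter h g - h j.
Proof. by rewrite /hom_of_letter iterated_sumXV mulr1. Qed.

Lemma hom_of_letterM h g u :
  hom_of_letter h (g * u)%g = hom_of_letter h g + hom_of_letter h u.
Proof.
elim/free_group_ind: u => [|u j IH|u j IH].
- by rewrite mulg1 /hom_of_letter iterated_sum1 addr0.
- by rewrite mulgA !hom_of_letterX IH addrA.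
- by rewrite mulgA !hom_of_letterXV IH addrA.
Qed.

(** The leading term of the difference along [u] only sees the image of [u] in the
    abelianisation. *)
Lemma iterated_sum_rdiff_top h l u : polynomial_fun (size l)
  (fun g => iterated_sum (h :: l) (g * u)%g - iterated_sum (h :: l) g -
            hom_of_letter h u * iterated_sum l g).
Proof.
elim/free_group_ind: u => [|u j IH|u j IH].
- rewrite (_ : (fun g => _) = fun=> 0); first exact: polynomial0.
  by apply/funext => g; rewrite mulg1 subrr /hom_of_letter iterated_sum1 mul0r subr0.
- rewrite (_ : (fun g => _) = fun g =>
    (iterated_sum (h :: l) (g * u)%g - iterated_sum (h :: l) g -
      hom_of_letter h u * iterated_sum l g)
    + h j * (iterated_sum l (g * u)%g - iterated_sum l g)).
    apply: polynomialD => //; apply: polynomialZ.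
    exact/polynomial_rdiff/iterated_sum_polynomial.
  by apply/funext => g; rewrite mulgA iterated_sumX hom_of_letterX; ring.
- rewrite (_ : (fun g => _) = fun g =>
    (iterated_sum (h :: l) (g * u)%g - iterated_sum (h :: l) g -
      hom_of_letter h u * iterated_sum l g)
    - h j * (iterated_sum l (g * (u * (X j)^-1))%g - iterated_sum l g)).
    apply: polynomialB => //; apply: polynomialZ.
    exact/polynomial_rdiff/iterated_sum_polynomial.
  apply/funext => g; rewrite !mulgA iterated_sumXV hom_of_letterXV; ring.
Qed.

(** Letters are homomorphisms from [F] to the integers, written in the dual basis. *)
Definition pullback al h : letter := [ffun j => hom_of_letter h (al (X j))].

Lemma hom_of_letter_pullback al h g : {morph al : x y / (x * y)%g} ->
  hom_of_letter (pullback al h) g = hom_of_letter h (al g).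
Proof.
move=> alM; have al1 : al 1%g = 1%g by apply: (mulgI (al 1%g)); rewrite -alM !mulg1.
have alV x : al x^-1%g = (al x)^-1%g by apply: (mulgI (al x)); rewrite -alM !mulgV.
have homV u : hom_of_letter h u^-1%g = - hom_of_letter h u.
  apply: (addrI (hom_of_letter h u)).
  by rewrite -hom_of_letterM mulgV subrr /hom_of_letter iterated_sum1.
elim/free_group_ind: g => [|g j IH|g j IH].
- by rewrite al1 /hom_of_letter !iterated_sum1.
- by rewrite hom_of_letterX alM hom_of_letterM IH ffunE.
- by rewrite hom_of_letterXV alM hom_of_letterM IH alV homV ffunE.
Qed.

(** On iterated sums of degree [c], modulo functions of lower degree, an
    endomorphism acts as the [c]-th tensor power of its action on homomorphisms. *)
Lemma iterated_sum_endomorphism al l : {morph al : x y / (x * y)%g} ->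
  polynomial_fun (size l)
    (fun g => iterated_sum l (al g) - iterated_sum (map (pullback al) l) g).
Proof.
move=> alM; elim: l => [|h l IH] /=; first by move=> g; rewrite subrr.
move=> j; pose R g := iterated_sum (h :: l) (g * al (X j))%g - iterated_sum (h :: l) g -
  hom_of_letter h (al (X j)) * iterated_sum l g.
rewrite (_ : rdiff _ _ = fun g => R (al g) + hom_of_letter h (al (X j)) *
   (iterated_sum l (al g) - iterated_sum (map (pullback al) l) g)).
  apply: polynomialD; last exact: polynomialZ.
  exact/polynomial_endomorphism/iterated_sum_rdiff_top.
apply/funext => g; rewrite /rdiff /R alM.
rewrite -[integral _ (g * _)%g]/(iterated_sum (_ :: map (pullback al) l) _).
rewrite -[X in _ - (_ - X)]/(iterated_sum (pullback al h :: map (pullback al) l) _).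
rewrite iterated_sumX ffunE /=; ring.
Qed.

Lemma iterated_sumD l1 h h' l2 g :
  iterated_sum (l1 ++ (h + h') :: l2) g =
  iterated_sum (l1 ++ h :: l2) g + iterated_sum (l1 ++ h' :: l2) g.
Proof.
have eqS phi psi theta : phi 1%g = 0 -> psi 1%g = 0 -> theta 1%g = 0 ->
    (forall j g', rdiff j theta g' = rdiff j phi g' + rdiff j psi g') ->
    forall g', theta g' = phi g' + psi g' :> int.
  move=> phi1 psi1 theta1 th g'.
  have -> : theta = fun g' => phi g' + psi g' => //.
  apply: eq_from_rdiff; rewrite ?phi1 ?psi1 ?theta1 // => j g''.
  by rewrite th /rdiff opprD addrACA.
elim: l1 g => [|k l1 IH] g /=; apply: eqS; rewrite ?integral1 // => j g'.
  by rewrite !rdiff_integral ffunE mulrDl.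
by rewrite !rdiff_integral IH mulrDr.
Qed.

Lemma iterated_sum_letter0 l1 l2 g : iterated_sum (l1 ++ 0 :: l2) g = 0.
Proof.
by apply: (addIr (iterated_sum (l1 ++ 0 :: l2) g)); rewrite -iterated_sumD addr0 add0r.
Qed.

Definition basis_letter j : letter := [ffun i => (i == j)%:R].

Definition coefficient (I : seq 'I_n) : F -> int := iterated_sum (map basis_letter I).

(** Sequences are stored from the last letter to the first, so those considered here
    begin with [T] and continue with a letter other than [i].  Appending [X i] to [u]
    changes a coefficient by the one at the sequence without a final [i], which is again
    of this kind. *)
Lemma coefficient_extension0 T u i b : 
  (forall J j, j != i -> coefficient (J ++ j :: T) u = 0) ->
  forall J j, j != i ->
    coefficient (J ++ j :: T) (u * letter_val X (i, b))%g = 0.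
Proof.
move=> u0 J j ji; elim: J => [|p J IH].
  have := u0 [::] j ji; rewrite /coefficient /letter_val; case: b => /=.
    by rewrite integralX ffunE eq_sym (negPf ji) mul0r addr0.
  rewrite -/(iterated_sum (_ :: _)) iterated_sumXV ffunE eq_sym (negPf ji) mul0r subr0.
  by [].
have := u0 (p :: J) j ji; rewrite /coefficient /letter_val in IH *.
case: b IH => /= IH; rewrite -/(iterated_sum (_ :: _)).
  rewrite iterated_sumX => ->; rewrite ffunE add0r.
  have [ip|] := eqVneq; last by rewrite mul0r.
  by rewrite -[iterated_sum _ u]/(coefficient (J ++ j :: T) u) u0 // mulr0.
by rewrite iterated_sumXV => ->; rewrite IH mulr0 subr0.
Qed.

Lemma coefficient_neq T i p u b : p != i ->
  coefficient (p :: T) (u * letter_val X (i, b))%g = coefficient (p :: T) u.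
Proof.
move=> pi; rewrite /coefficient /letter_val; case: b => /=.
  by rewrite integralX ffunE eq_sym (negPf pi) mul0r addr0.
rewrite -/(iterated_sum (_ :: _)) iterated_sumXV ffunE eq_sym (negPf pi) mul0r.
by rewrite subr0.
Qed.

Lemma coefficient_eq T i u b :
  coefficient (i :: T) (u * letter_val X (i, b))%g = coefficient (i :: T) u +
    (-1) ^+ (~~ b) * coefficient T (if b then u else u * letter_val X (i, b))%g.
Proof.
rewrite /coefficient /letter_val; case: b => /=.
  by rewrite integralX ffunE eqxx !mul1r.
rewrite -/(iterated_sum (_ :: _)) iterated_sumXV ffunE eqxx mul1r mulN1r.
by [].
Qed.

(** Magnus: if a reduced word consists of the powers [X i_1 ^+ k_1], ..., with
    consecutive indices distinct, then its coefficient at [i_1, ..., i_s] is the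
    product of the [k_j].  The induction over prefixes [w, (i, b)] carries the product
    [C] over all powers but the last, the last exponent [k], of the sign of [b], and
    the vanishing of the coefficients at longer sequences. *)
Lemma coefficient_reduced w i b : reduced (rcons w (i, b)) ->
  let u := word_val X (rcons w (i, b)) in
  exists (I : seq 'I_n) (C k : int),
    [/\ forall T, I <> i :: T, C != 0 & coefficient I u = C] /\
    [/\ coefficient (i :: I) u = k * C, 0 < (-1) ^+ (~~ b) * k &
        forall J j, j != i -> coefficient (J ++ j :: i :: I) u = 0].
Proof.
elim/last_ind: w i b => [|w [i b] IH] i' b' red; rewrite word_val_rcons.
  have -> : word_val X [::] = 1%g by rewrite /word_val big_nil.
  have coef1 p T : coefficient (p :: T) 1%g = 0 by apply: iterated_sum1.
  exists [::], 1, ((-1) ^+ (~~ b')); split; first by split.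
  split; first by rewrite coefficient_eq coef1 add0r mulr1; case: (b').
    by case: (b').
  move=> J j ji; apply: coefficient_extension0 => // J' j' _.
  by case: J' => [|p J'] /=; apply: coef1.
have [red_w ib] : reduced (rcons w (i, b)) /\ (i', b') != (i, ~~ b).
  move: red; rewrite /reduced; case: w {IH} => [|l w] /=; first by rewrite andbT.
  by rewrite rcons_path last_rcons => /andP[].
have [I [C [k [[Ii C0 IC] [iIC k_sign vanish]]]]] := IH i b red_w.
set u := word_val X _ in IC iIC vanish *.
have [ii'|ii'] := eqVneq i' i.
  have bb' : b' = b by case: (b') (b) ib => [] []; rewrite ii' ?eqxx.
  rewrite {}ii' {}bb' {ib red i' b'}.
  have Iu : coefficient I (u * letter_val X (i, b))%g = C.
    rewrite -IC; case: I Ii {IC iIC vanish} => // p T pT; apply: coefficient_neq.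
    by apply/eqP => pi; apply: (pT T); rewrite pi.
  exists I, C, (k + (-1) ^+ (~~ b)); split; first by split.
  split.
  - by rewrite coefficient_eq iIC; case: (b) Iu => Iu; rewrite ?IC ?Iu mulrDl.
  - by case: (b) k_sign => /=; rewrite ?mul1r ?mulN1r; lia.
  - by move=> J j ji; apply: coefficient_extension0.
have ii'_sym : i != i' by rewrite eq_sym.
have vanish' J j : j != i' -> coefficient (J ++ j :: i' :: i :: I) u = 0.
  by move=> _; have := vanish (rcons J j) i' ii'; rewrite cat_rcons.
have iIu : coefficient (i :: I) (u * letter_val X (i', b'))%g = k * C.
  by rewrite coefficient_neq.
exists (i :: I), (k * C), ((-1) ^+ (~~ b')); split.
  split=> // [T [/eqP]|]; first by rewrite (negPf ii'_sym).
  by rewrite mulf_neq0 //; apply/eqP => k0; rewrite k0 mulr0 in k_sign.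
split.
- rewrite coefficient_eq [X in X + _](vanish [::] i' ii') add0r.
  by case: (b') iIu => iIu; rewrite ?iIC ?iIu.
- by case: (b').
- by move=> J j ji; apply: coefficient_extension0.
Qed.

(** * Dimension subgroups *)

(** Polynomial functions of degree less than [c] are the linear forms on the integral
    group ring that vanish on the [c]-th power of the augmentation ideal, so these are
    the classical dimension subgroups. *)
Definition dimension_subgroup c u : Prop :=
  forall phi : F -> int, polynomial_fun c phi -> phi u = phi 1%g.

Lemma dimension_subgroups_separated u :
  (forall c, dimension_subgroup c u) -> u = 1%g.
Proof.
move=> dim_u; have [w [[w_red wu] _]] := X_basis u.
case: w => [|l w] in w_red wu *; first by rewrite -wu /word_val big_nil.
case/lastP: {l w}(l :: w) w_red wu => [|w [i b]] w_red wu.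
  by rewrite -wu /word_val big_nil.
have [I [C [k [[_ C0 _] [iIC k0 _]]]]] := coefficient_reduced w_red.
have := dim_u _ _ (iterated_sum_polynomial (map basis_letter (i :: I))).
rewrite iterated_sum1 -wu -[iterated_sum _ _]/(coefficient _ _) iIC => /eqP.
rewrite mulf_eq0 (negPf C0) orbF => /eqP kz.
by rewrite kz mulr0 in k0.
Qed.

Lemma dimension_subgroup_leq c d u :
  (c <= d)%N -> dimension_subgroup d u -> dimension_subgroup c u.
Proof. by move=> cd dim_u phi Pphi; apply/dim_u/(polynomial_leq cd). Qed.

Lemma dimension_subgroup1 u : dimension_subgroup 1 u.
Proof. by move=> phi /polynomial1_const. Qed.

Lemma dimension_subgroupJ c g u :
  dimension_subgroup c u -> dimension_subgroup c (g * u * g^-1)%g.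
Proof.
move=> dim_u phi Pphi; rewrite (dim_u (fun u => phi (g * u * g^-1)%g)).
  by rewrite mulg1 mulgV.
exact/(@polynomial_ltrans _ _ (fun u => phi (u * g^-1)%g))/polynomial_rtrans.
Qed.

(** On the [c]-th dimension subgroup, a function of degree [c] is additive, because its
    differences have degree less than [c] and so are constant there. *)
Section HomogeneousFunctional.
Variables (c : nat) (phi : F -> int).
Hypotheses (Pphi : polynomial_fun c.+1 phi) (phi1 : phi 1%g = 0).

Lemma homogeneousMr u g :
  dimension_subgroup c u -> phi (u * g)%g = phi u + phi g.
Proof.
move=> dim_u; have /dim_u := polynomial_rdiff g Pphi.
by rewrite mul1g phi1 subr0 => /eqP; rewrite subr_eq addrC => /eqP.
Qed.

Lemma homogeneousMl g u :
  dimension_subgroup c u -> phi (g * u)%g = phi g + phi u.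
Proof.
move=> dim_u; have /dim_u := polynomial_ldiff g Pphi.
by rewrite mulg1 phi1 subr0 => /eqP; rewrite subr_eq => /eqP.
Qed.

Lemma homogeneousJ g u :
  dimension_subgroup c u -> phi (g * u * g^-1)%g = phi u.
Proof.
move=> dim_u; apply: (addIr (phi g)).
rewrite -homogeneousMr; last exact: dimension_subgroupJ.
by rewrite mulgVK homogeneousMl // addrC.
Qed.

End HomogeneousFunctional.

Inductive homogeneous_span (c : nat) : (F -> int) -> Prop :=
| HomogeneousSpan0 : homogeneous_span c (fun=> 0)
| HomogeneousSpanS phi a I : homogeneous_span c phi -> size I = c ->
    homogeneous_span c (fun g => a * coefficient I g + phi g).

Lemma homogeneous_spanD c phi psi : homogeneous_span c phi ->
  homogeneous_span c psi -> homogeneous_span c (fun g => phi g + psi g).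
Proof.
move=> + Hpsi; elim=> [|phi' a I _ IH sI].
  by rewrite (_ : (fun g => _) = psi) //; apply/funext => g; rewrite add0r.
rewrite (_ : (fun g => _) = fun g => a * coefficient I g + (phi' g + psi g)).
  exact: HomogeneousSpanS.
by apply/funext => g; rewrite addrA.
Qed.

Lemma homogeneous_span_integral c phi i : homogeneous_span c phi ->
  exists2 Phi, homogeneous_span c.+1 Phi &
    forall j g, rdiff j Phi g = if j == i then phi g else 0.
Proof.
elim=> [|phi' a I _ [Phi HPhi PhiE] sI].
  exists (fun=> 0); first exact: HomogeneousSpan0.
  by move=> j g; rewrite /rdiff subrr if_same.
exists (fun g => a * coefficient (i :: I) g + Phi g).
  by apply: HomogeneousSpanS; rewrite //= sI.
move=> j g; rewrite (_ : rdiff _ _ _ =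
  a * rdiff j (coefficient (i :: I)) g + rdiff j Phi g); last first.
  by rewrite /rdiff mulrBr opprD addrACA.
rewrite PhiE /coefficient /= rdiff_integral ffunE.
by case: eqP => _; rewrite ?mul1r // mul0r mulr0 addr0.
Qed.

(** The coefficients of degree [c] span the polynomial functions of degree at most
    [c], modulo those of lower degree. *)
Lemma polynomial_homogeneous_span c phi : polynomial_fun c.+1 phi ->
  exists2 Phi, homogeneous_span c Phi & polynomial_fun c (fun g => phi g - Phi g).
Proof.
elim: c phi => [phi Pphi|c IH phi Pphi].
  exists (fun g => phi 1%g * coefficient [::] g + 0).
    by apply: HomogeneousSpanS => //; apply: HomogeneousSpan0.
  by move=> g; rewrite /coefficient /= mulr1 addr0 polynomial1_const // subrr.
have /choice[Psi PsiP] : forall j, exists Psi, homogeneous_span c Psi /\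
    polynomial_fun c (fun g => rdiff j phi g - Psi g).
  by move=> j; have [Psi] := IH _ (Pphi j); exists Psi.
have [Phi HPhi PhiE] : exists2 Phi, homogeneous_span c.+1 Phi &
    forall j g, rdiff j Phi g = if j \in enum 'I_n then Psi j g else 0.
  elim: (enum 'I_n) (enum_uniq 'I_n) => [_|i s IHs /= /andP[i_s /IHs[Phi HPhi PhiE]]].
    exists (fun=> 0); first exact: HomogeneousSpan0.
    by move=> j g; rewrite /rdiff subrr.
  have [Phi' HPhi' Phi'E] := homogeneous_span_integral i (proj1 (PsiP i)).
  exists (fun g => Phi' g + Phi g); first exact: homogeneous_spanD.
  move=> j g; rewrite (_ : rdiff _ _ _ = rdiff j Phi' g + rdiff j Phi g); last first.
    by rewrite /rdiff opprD addrACA.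
  rewrite Phi'E PhiE inE; case: eqP => [->|_] /=; last by rewrite add0r.
  by rewrite (negPf i_s) addr0.
exists Phi => // j; rewrite (_ : rdiff _ _ = fun g => rdiff j phi g - Psi j g).
  by case: (PsiP j).
apply/funext => g; have := PhiE j g; rewrite mem_enum inE => <-.
by rewrite /rdiff !opprD addrACA.
Qed.

(** Consecutive dimension subgroups differ by finitely many functionals. *)
Lemma dimension_subgroupS c u : dimension_subgroup c u ->
  (forall I, size I = c -> coefficient I u = coefficient I 1%g) ->
  dimension_subgroup c.+1 u.
Proof.
move=> dim_u coef0 phi /polynomial_homogeneous_span[Phi HPhi /dim_u].
suff -> : Phi u = Phi 1%g by move/addIr.
elim: HPhi => // psi a I _ -> sI.
by rewrite coef0.
Qed.

(** * Polynomial functions with values in a finite group *)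

(** Polynomial functions with values in a finite abelian group form a finite set,
    enumerated by the following codes. *)
Section Codes.
Variable A : finZmodType.

Fixpoint polynomial_code c : finType :=
  if c is c'.+1 then (A * {ffun 'I_n -> polynomial_code c'})%type else unit.

Fixpoint decode c : polynomial_code c -> F -> A :=
  if c is c'.+1 then
    fun e g => e.1 + integral (fun j => decode (e.2 j)) g
  else fun _ _ => 0.

Fixpoint encode c (phi : F -> A) : polynomial_code c :=
  if c is c'.+1 then (phi 1%g, [ffun j => encode c' (rdiff j phi)]) else tt.

Lemma rdiff_decode c (e : polynomial_code c.+1) j :
  rdiff j (decode e) = decode (e.2 j).
Proof.
by apply/funext => g; rewrite /rdiff /= integralX [e.1 + (_ + _)]addrA [X in X - _]addrC addrK.
Qed.

Lemma decodeK c : cancel (@decode c) (@encode c).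
Proof.
elim: c => [[] //|c IH e].
have -> : encode c.+1 (decode e) =
    (decode e 1%g, [ffun j => encode c (rdiff j (decode e))]) by [].
rewrite [e in RHS]surjective_pairing; congr pair; first by rewrite /= integral1 addr0.
by apply/ffunP => j; rewrite ffunE rdiff_decode IH.
Qed.

Lemma encodeK c phi : polynomial_fun c phi -> decode (encode c phi) = phi.
Proof.
elim: c phi => [phi phi0|c IH phi Pphi]; first by apply/funext => g; rewrite phi0.
apply: eq_from_rdiff; first by rewrite /= integral1 addr0.
by move=> j g; rewrite rdiff_decode ffunE IH.
Qed.

Lemma decode_polynomial c (e : polynomial_code c) : polynomial_fun c (decode e).
Proof. by elim: c e => [|c IH] e j; rewrite ?rdiff_decode; first by []; apply: IH. Qed.

End Codes.

End IteratedSums.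
End FreeGroup.

(** * Polynomial growth and unipotence *)

Lemma exponential_gt_polynomial C d : exists2 M, (0 < M)%N & (C * M ^ d < 2 ^ M)%N.
Proof.
(* The exponent [M] is a power of 2, which makes both sides powers of 2. *)
have [s sE] : exists s, s = (2 * d + C + 1)%N by eexists.
have [p pE] : exists p, p = (2 ^ (2 * s))%N by eexists.
have p0 : (0 < p)%N by rewrite pE expn_gt0.
exists p; first exact: p0.
have C2 : (C < 2 ^ C)%N by apply: ltn_expl.
apply: (@leq_trans (2 ^ C * p ^ d)%N); first by rewrite ltn_pmul2r // expn_gt0 p0.
rewrite [in X in (X <= _)%N]pE -expnM -expnD leq_exp2l //.
apply: (@leq_trans (s * s)%N); first by rewrite sE; nia.
rewrite pE mulnC expnM expnS expn1; apply: leq_mul; apply/ltnW/ltn_expl => //.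
Qed.

Section Unipotence.
Variables (F : groupType) (n : nat) (X : 'I_n -> F) (X_basis : free_basis X).

Local Notation hom := (hom_of_letter X_basis).
Local Notation pull := (pullback X_basis).
Implicit Types (h : letter n) (al be : F -> F).

Lemma hom_of_letter1 h : hom h 1%g = 0.
Proof. exact: iterated_sum1. Qed.

Lemma hom_of_letterV h u : hom h u^-1%g = - hom h u.
Proof. by apply: (addrI (hom h u)); rewrite -hom_of_letterM mulgV subrr hom_of_letter1. Qed.

Lemma hom_of_letterJ h u v : hom h (u ^ v)%g = hom h u.
Proof. by rewrite /conjg !hom_of_letterM hom_of_letterV addrC addrK. Qed.

Lemma hom_of_letterX1 h j : hom h (X j) = h j.
Proof. by rewrite -[X j]mul1g hom_of_letterX hom_of_letter1 add0r. Qed.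

Lemma pullbackD al h h' : pull al (h + h') = pull al h + pull al h'.
Proof. by apply/ffunP => j; rewrite !ffunE; apply: (iterated_sumD X_basis [::]). Qed.

Lemma pullbackMn al h k : pull al (h *+ k) = pull al h *+ k.
Proof.
elim: k => [|k IH]; last by rewrite !mulrS pullbackD IH.
by rewrite !mulr0n; apply: (addIr (pull al 0)); rewrite -pullbackD addr0 add0r.
Qed.

Lemma pullbackN al h : pull al (- h) = - pull al h.
Proof.
apply: (addIr (pull al h)); rewrite -pullbackD !addNr.
by have := pullbackMn al h 0; rewrite !mulr0n.
Qed.

Lemma pullback_comp al be h : {morph be : x y / (x * y)%g} ->
  pull al (pull be h) = pull (be \o al) h.
Proof. by move=> beM; apply/ffunP => j; rewrite !ffunE hom_of_letter_pullback. Qed.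

Lemma pullback_id h : pull id h = h.
Proof. by apply/ffunP => j; rewrite ffunE hom_of_letterX1. Qed.

Lemma morph_iter al k : {morph al : x y / (x * y)%g} -> {morph iter k al : x y / (x * y)%g}.
Proof. by move=> alM; elim: k => // k IH x y; rewrite /= IH alM. Qed.

Lemma pullback_iter al k h : {morph al : x y / (x * y)%g} ->
  pull (iter k al) h = iter k (pull al) h.
Proof.
move=> alM; elim: k => [|k IH]; first exact: pullback_id.
rewrite iterS -IH pullback_comp; last exact: morph_iter.
by congr pullback; apply/funext => x; rewrite /= -iterS iterSr.
Qed.

Definition congruent (q : nat) h h' : Prop := exists h'', h = h' + h'' *+ q.

(** The action of an automorphism on the finite set of letters modulo [q] is a
    permutation, hence of finite order. *)
Lemma pullback_finite_order q al be : (0 < q)%N -> {morph al : x y / (x * y)%g} ->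
  {morph be : x y / (x * y)%g} -> cancel be al ->
  exists2 N, (0 < N)%N & forall h, congruent q (iter N (pull al) h) h.
Proof.
case: q => // q _ alM beM beK.
have q0 : q.+1%:Z != 0 by [].
pose red h : {ffun 'I_n -> 'I_q.+1} := [ffun j => inord `|(h j %% q.+1%:Z)%Z|].
pose lift (r : {ffun 'I_n -> 'I_q.+1}) : letter n := [ffun j => (r j)%:Z].
have redE h j : (red h j)%:Z = (h j %% q.+1%:Z)%Z.
  rewrite ffunE inordK; first by rewrite gez0_abs // modz_ge0.
  by rewrite -ltz_nat gez0_abs ?modz_ge0 // ltz_pmod.
have red_congruent h h' : red h = red h' <-> congruent q.+1 h h'.
  split=> [/ffunP hh'|[k ->]].
    exists [ffun j => (h j %/ q.+1%:Z)%Z - (h' j %/ q.+1%:Z)%Z].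
    apply/ffunP => j; rewrite !ffunE ffunMnE ffunE.
    have e : (h j %% q.+1%:Z)%Z = (h' j %% q.+1%:Z)%Z by rewrite -!redE hh'.
    rewrite -mulr_natr natz [LHS](divz_eq (h j) q.+1%:Z) e.
    rewrite [X in _ = X + _](divz_eq (h' j) q.+1%:Z); ring.
  apply/ffunP => j; apply/val_inj/eqP; rewrite /= -eqz_nat !redE !ffunE ffunMnE.
  by rewrite -mulr_natr natz addrC modzMDl.
have redK h : congruent q.+1 (lift (red h)) h.
  apply/red_congruent/ffunP => j; apply/val_inj/eqP; rewrite /= -eqz_nat !redE.
  by rewrite ffunE redE modz_mod.
have pull_congruent ga h h' : congruent q.+1 h h' -> congruent q.+1 (pull ga h) (pull ga h').
  by case=> k ->; exists (pull ga k); rewrite pullbackD pullbackMn.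
pose T r := red (pull al (lift r)).
have TK : cancel T (fun r => red (pull be (lift r))).
  move=> r; have -> : red (pull be (lift (T r))) = red (pull be (pull al (lift r))).
    exact/red_congruent/pull_congruent/redK.
  rewrite pullback_comp // (_ : al \o be = id) ?pullback_id; last exact/funext.
  apply/ffunP => j; apply/val_inj/eqP; rewrite /= -eqz_nat redE ffunE modz_small //.
  by rewrite /= ltz_nat ltn_ord.
have redT h k : red (iter k (pull al) h) = iter k T (red h).
  elim: k => //= k <-; apply/red_congruent/pull_congruent.
  by have [m e] := redK (iter k (pull al) h); exists (- m); rewrite e mulNrn addrK.
exists #[perm (can_inj TK)]%g; first exact: order_gt0.
move=> h; apply/red_congruent; rewrite redT.
rewrite -[iter _ T _](_ : (perm (can_inj TK) ^+ #[perm (can_inj TK)])%g (red h) = _).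
  by rewrite expg_order perm1.
by rewrite permX; apply: eq_iter => r; rewrite permE.
Qed.

Lemma hom_basis_letter_word i w : (`|hom (basis_letter i) (word_val X w)| <= size w)%N.
Proof.
elim/last_ind: w => [|w [j b] IH]; first by rewrite /word_val big_nil hom_of_letter1.
rewrite word_val_rcons hom_of_letterM size_rcons.
have : (`|hom (basis_letter i) (letter_val X (j, b))| <= 1)%N.
  by case: b; rewrite /letter_val /= ?hom_of_letterV hom_of_letterX1 ffunE; case: eqP.
lia.
Qed.

(** Homomorphisms are constant on conjugacy classes and bounded by the word length, so
    the growth of classes bounds that of the action on homomorphisms. *)
Lemma class_growth_bound psi i j d :
  (exists2 d', (d' <= d)%N & class_growth X psi (X j) d') ->
  exists B : nat, forall k : nat,
    (`|hom (basis_letter i) (iter k psi (X j))| <= B * k.+1 ^ d)%N.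
Proof.
case=> d' d'd [A [B [_ B0 growth]]]; exists (Num.bound B).+1 => -[|k].
  rewrite exp1n muln1 /= hom_of_letterX1 ffunE; case: eqP => //.
have [m [[w [v _ vw] wm] _] /andP[_ mB]] := growth k.+1 isT.
have -> : hom (basis_letter i) (iter k.+1 psi (X j)) = hom (basis_letter i) (word_val X w).
  by rewrite -vw hom_of_letterJ.
apply: (leq_trans (hom_basis_letter_word i w)); rewrite wm.
apply: (@leq_trans (Num.bound B * k.+1 ^ d')%N).
  rewrite -(ler_nat Rdefinitions.R) natrM natrX; apply: (le_trans mB).
  apply: ler_wpM2r; first by rewrite exprn_ge0.
  exact/ltW/archi_boundP/ltW.
apply: leq_mul; first exact: leqnSn.
apply: (@leq_trans (k.+1 ^ d)%N); first by rewrite leq_pexp2l.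
by case: (d) => // d''; rewrite leq_exp2r.
Qed.

(** Let [P] be the action on letters of a power of [psi] that is trivial modulo 4.
    The letter [(P - 1)^M h] is divisible by [4^M], whereas it is the [M]-th finite
    difference of a sequence of polynomial growth, and hence bounded by [2^M] times
    a polynomial in [M].  So it vanishes for some [M]. *)
Lemma polynomial_growth_unipotent psi psi' d :
  {morph psi : x y / (x * y)%g} -> {morph psi' : x y / (x * y)%g} ->
  cancel psi' psi -> growth_degree X psi d ->
  exists N M : nat, (0 < N)%N /\
    forall i, iter M (fun h => pull (iter N psi) h - h) (basis_letter i) = 0.
Proof.
move=> psiM psi'M psiK [growth _].
have [N N0 psiN] := pullback_finite_order (isT : 0 < 4)%N psiM psi'M psiK.
have /choice[B0 B0P] : forall ij : 'I_n * 'I_n, exists B : nat, forall k : nat,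
    (`|hom (basis_letter ij.1) (iter k psi (X ij.2))| <= B * k.+1 ^ d)%N.
  by move=> ij; apply/class_growth_bound/growth.
pose B := (\sum_ij B0 ij)%N.
have BP i j k : (`|iter k (pull psi) (basis_letter i) j| <= B * k.+1 ^ d)%N.
  rewrite -pullback_iter // ffunE; apply: (leq_trans (B0P (i, j) k)).
  by rewrite leq_mul2r; apply/orP; right; rewrite /B (bigD1 (i, j)) //= leq_addr.
have [M M0 MP] := exponential_gt_polynomial (B * (N + 1) ^ d) d.
exists N, M; split=> // i.
set P := pull (iter N psi); pose D h := P h - h.
have PB h h' : P (h - h') = P h - P h' by rewrite /P pullbackD pullbackN.
have PMn h k : P (h *+ k) = P h *+ k by rewrite /P pullbackMn.
have iterPB m h h' : iter m P (h - h') = iter m P h - iter m P h'.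
  by elim: m => //= m ->; rewrite PB.
have divisible m : exists h, iter m D (basis_letter i) = h *+ 4 ^ m.
  elim: m => [|m [h IH]]; first by exists (basis_letter i).
  have [h' Ph] := psiN h; exists h'.
  rewrite iterS IH /D PMn -mulrnBl /P pullback_iter // Ph addrC addKr.
  by rewrite -mulrnA expnS.
have bounded j m k : (m + k <= M)%N ->
    (`|iter k P (iter m D (basis_letter i)) j| <= 2 ^ m * (B * (N * M).+1 ^ d))%N.
  elim: m k => [|m IH] k mk.
    have -> h : iter k P h = iter (k * N) (pull psi) h.
      by rewrite iterM; apply: eq_iter => h'; rewrite /P pullback_iter.
    rewrite expn0 mul1n; apply: (leq_trans (BP _ _ _)); rewrite leq_mul2l; apply/orP.
    right; case: (d) => // d'; rewrite leq_exp2r // ltnS mulnC leq_mul2l.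
    by rewrite (leq_trans _ mk) ?orbT.
  have subE (u v : letter n) : (u - v) j = u j - v j by rewrite !ffunE.
  rewrite iterS {1}/D iterPB -iterSr subE.
  have := IH k.+1; rewrite addnS -addSn => /(_ mk).
  have := IH k; rewrite (ltnW (_ : m + k < M)%N) // => /(_ isT).
  rewrite expnS -mulnA; set bnd := (2 ^ m * _)%N.
  move: (iter k P _ j) (iter k.+1 P _ j) => x y xbnd ybnd; lia.
apply/ffunP => j; rewrite ffunE.
have [h hE] := divisible M; have := bounded j M 0 (_ : M + 0 <= M)%N.
rewrite addn0 leqnn => /(_ isT) /=; rewrite -/D hE ffunMnE => bnd.
suff -> : h j = 0 by rewrite mul0rn.
apply/eqP/negPn/negP => hj0; move: bnd; apply/negP; rewrite -ltnNge.
rewrite -mulr_natr natz abszM absz_nat.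
apply: (@leq_trans (4 ^ M)%N); last by rewrite leq_pmull // absz_gt0.
rewrite -[4%N]/(2 * 2)%N expnMn ltn_pmul2l ?expn_gt0 //.
apply: leq_ltn_trans MP; rewrite -mulnA -expnMn leq_mul2l; apply/orP; right.
by case: (d) => // d'; rewrite leq_exp2r // mulnDl mul1n -addn1 leq_add2l.
Qed.

End Unipotence.

(** * Weights *)

Section Weights.
Variables (F : groupType) (n : nat) (X : 'I_n -> F) (X_basis : free_basis X).
Variables (al : F -> F) (M : nat).
Hypothesis alM : {morph al : x y / (x * y)%g}.

Local Notation pull := (pullback X_basis al).

(** When [pull - 1] is nilpotent on letters, these letters form a finite family on
    which [pull] is triangular; the number of factors [pull - 1] is the weight. *)
Definition weighted_letter (p : 'I_n * nat) : letter n :=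
  iter p.2 (fun h => pull h - h) (basis_letter p.1).

Definition weighted_letters : seq ('I_n * nat) -> seq (letter n) := map weighted_letter.

Definition weight (s : seq ('I_n * nat)) : nat := sumn (map snd s).

Lemma weight_cat s1 s2 : weight (s1 ++ s2) = (weight s1 + weight s2)%N.
Proof. by rewrite /weight map_cat sumn_cat. Qed.

Lemma pullback_weighted_letter i m :
  pull (weighted_letter (i, m)) = weighted_letter (i, m) + weighted_letter (i, m.+1).
Proof. by rewrite /weighted_letter /= addrC subrK. Qed.

(** The endomorphism [al] acts trivially on the iterated sums of weight [m], up to
    iterated sums of larger weight. *)
Lemma iterated_sum_pullback_weighted c m u :
  (forall s, size s = c -> (m < weight s)%N ->
     iterated_sum X_basis (weighted_letters s) u = 0) ->
  forall s, size s = c -> (m <= weight s)%N ->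
  iterated_sum X_basis (map pull (weighted_letters s)) u =
  iterated_sum X_basis (weighted_letters s) u.
Proof.
move=> u0; have gen s s2 : size (s ++ s2) = c -> (m <= weight (s ++ s2))%N ->
    iterated_sum X_basis (map pull (weighted_letters s) ++ weighted_letters s2) u =
    iterated_sum X_basis (weighted_letters (s ++ s2)) u.
  elim/last_ind: s s2 => [|s [i k] IH] s2 //; rewrite cat_rcons => sz wt.
  rewrite /weighted_letters !map_rcons cat_rcons pullback_weighted_letter iterated_sumD.
  rewrite -2![_ :: map _ _]/(weighted_letters (_ :: s2)) !IH //.
    rewrite [X in _ + X]u0 ?addr0 //; first by move: sz; rewrite !size_cat.
    by move: wt; rewrite !weight_cat /weight /= addSn addnS ltnS.
  - by move: sz; rewrite !size_cat.
  - by move: wt; rewrite !weight_cat /weight /= addSn addnS => /leqW.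
by move=> s sz wt; have := gen s [::]; rewrite /= !cats0; apply.
Qed.

Lemma iterated_sum_endomorphism_homogeneous l u : l != [::] ->
  dimension_subgroup X (size l) u ->
  iterated_sum X_basis l (al u) = iterated_sum X_basis (map pull l) u.
Proof.
case: l => // h l _ /(_ _ (iterated_sum_endomorphism X_basis (h :: l) alM)).
rewrite (_ : al 1%g = 1%g); last by apply: (mulgI (al 1%g)); rewrite -alM !mulg1.
by rewrite !iterated_sum1 subrr => /subr0_eq.
Qed.

Hypothesis unipotent : forall i, weighted_letter (i, M) = 0.

Lemma weighted_letter0 i m : (M <= m)%N -> weighted_letter (i, m) = 0.
Proof.
move/subnK <-; rewrite /weighted_letter /= iterD.
rewrite [iter M _ _](unipotent i); elim: (m - M)%N => //= k ->.
by rewrite subr0; have := pullbackMn X_basis al 0 0; rewrite !mulr0n.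
Qed.

Lemma iterated_sum_weighted0 s u : ~~ all (fun p => p.2 < M)%N s ->
  iterated_sum X_basis (weighted_letters s) u = 0.
Proof.
case/allPn=> -[i m] /splitPr[s1 s2] /=; rewrite -leqNgt => Mm.
by rewrite /weighted_letters map_cat /= weighted_letter0 // iterated_sum_letter0.
Qed.

Lemma weight_lt s : s != [::] -> all (fun p => p.2 < M)%N s ->
  (weight s < size s * M)%N.
Proof.
elim: s => // -[i m] s IH _ /= /andP[mM sM]; rewrite /weight /= mulSn.
have [->|s0] := eqVneq s [::]; first by rewrite addn0 mul0n addn0.
by rewrite -addSn leq_add // ltnW // IH.
Qed.

End Weights.

Section ChainLemmas.
Variables (G : groupType) (G0 : G -> Prop).

Lemma central_functional_sub (N N' : G -> Prop) e :
  (forall z, N' z -> N z) -> central_functional G0 N e -> central_functional G0 N' e.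
Proof.
move=> N'N [eM eJ eK]; split=> [x y /N'N Nx /N'N Ny|g z Gg /N'N Nz|q /eK[K fK Ke]].
- exact: eM.
- exact: eJ.
- by exists K => // z /N'N; apply: Ke.
Qed.

Lemma central_chain_seq (I : eqType) (s : seq I) (e : I -> G -> int) N :
  (forall i, i \in s -> central_functional G0 N (e i)) ->
  central_chain G0 N (fun z => N z /\ forall i, i \in s -> e i z = 0).
Proof.
elim: s => [_|i s IH ce].
  rewrite (_ : (fun z => _) = N); first exact: CentralChain0.
  by apply/funext => z; apply/propext; split=> [[]|].
have cs : central_chain G0 N (fun z => N z /\ forall i, i \in s -> e i z = 0).
  by apply: IH => j js; apply: ce; rewrite inE js orbT.
have ci : central_functional G0 (fun z => N z /\ forall i, i \in s -> e i z = 0) (e i).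
  by apply: (central_functional_sub (N := N)) => [z []//|]; apply: ce; rewrite mem_head.
have := CentralChainS cs ci; congr central_chain; apply/funext => z; apply/propext.
split=> [[[Nz sz] iz]|[Nz sz]].
  by split=> // j; rewrite inE => /predU1P[->//|]; apply: sz.
split; last by apply: sz; rewrite mem_head.
by split=> // j js; apply: sz; rewrite inE js orbT.
Qed.

End ChainLemmas.

(** Doubling keeps away from the modulus 1, for which ['Z_1] is not trivial. *)
Lemma intr_Zp_double_eq0 (q : nat) (k : int) :
  (0 < q)%N -> k%:~R = 0 :> 'Z_q.*2 -> (q%:Z %| k)%Z.
Proof.
move=> q0; have p1 : (1 < q.*2)%N by rewrite -addnn; case: q q0 => // q _; rewrite addnS.
have nat0 (m : nat) : m%:R = 0 :> 'Z_q.*2 -> (q %| m)%N.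
  move/(congr1 val); rewrite /= val_Zp_nat // => /eqP; apply: dvdn_trans.
  by rewrite -muln2 dvdn_mulr.
case: k => m; first exact: nat0.
by rewrite NegzE mulrNz => /eqP; rewrite oppr_eq0 => /eqP/nat0.
Qed.

(** * The levels of a free-by-cyclic group *)

Section FreeByCyclic.
Variables (G : groupType) (chi : {multiplicative G -> Zgroup}) (t : G).
Hypothesis chi_t : chi t = Zgen.
Variables (n : nat) (X : 'I_n -> kernel chi) (X_basis : free_basis X).

Local Notation F := (kernel chi).

Definition height (g : G) : int := chi g.

Lemma heightM g h : height (g * h)%g = height g + height h.
Proof. by rewrite /height gmulfM. Qed.

Lemma height1 : height 1%g = 0.
Proof. by rewrite /height mult_morph1. Qed.

Lemma heightV g : height g^-1%g = - height g.
Proof. by rewrite /height mult_morphV. Qed.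

Lemma height_kernel (f : F) : height (val f) = 0.
Proof. by case: f => f /= /eqP. Qed.

Lemma height_zexpg k : height (zexpg t k) = k.
Proof.
elim/int_rect: k => [|k IH|k IH]; first exact: height1.
  by rewrite intS [1 + _]addrC zexpgS heightM IH /height chi_t.
by rewrite intS opprD addrC zexpgB1 heightM heightV IH /height chi_t.
Qed.

Lemma kernel_part_subproof g : in_ker chi (g * zexpg t (- height g))%g.
Proof. by apply/eqP; rewrite -[LHS]/(height _) heightM height_zexpg subrr. Qed.

(** The component in the kernel with respect to the splitting [t]. *)
Definition kernel_part g : F := Kernel (kernel_part_subproof g).

Lemma kernel_partE g : g = (val (kernel_part g) * zexpg t (height g))%g.
Proof. by rewrite /= -mulgA -zexpgD addNr mulg1. Qed.

Lemma val_kernel_part g : height g = 0 -> val (kernel_part g) = g.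
Proof. by move=> g0; rewrite /= g0 oppr0 mulg1. Qed.

Lemma kernel_part_val f : kernel_part (val f) = f.
Proof. by apply/val_inj/val_kernel_part/height_kernel. Qed.

Lemma kernel_partM g h : height g = 0 -> height h = 0 ->
  kernel_part (g * h)%g = (kernel_part g * kernel_part h)%g.
Proof.
move=> g0 h0; apply: val_inj; rewrite val_kernel_part; last by rewrite heightM g0 h0.
by rewrite valM !val_kernel_part.
Qed.

Lemma ker_conjM g : {morph ker_conj g : x y / (x * y)%g : F}.
Proof. by move=> x y; apply: val_inj; rewrite valM /= !mulgA mulgVK. Qed.

Section FiniteDetection.

(** The action of [G] on the left cosets of the cyclic group of [t]. *)
Definition coset_action g (f : F) : F := kernel_part (g * val f)%g.

Lemma coset_actionE g f :
  coset_action g f = (kernel_part g * ker_conj (zexpg t (height g)) f)%g.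
Proof.
apply: val_inj; rewrite valM /= heightM height_kernel addr0.
by rewrite !mulgA zexpgN mulgVK.
Qed.

Lemma coset_actionM g h f :
  coset_action (g * h)%g f = coset_action g (coset_action h f).
Proof.
apply: val_inj; rewrite /= !heightM !height_zexpg !height_kernel.
by rewrite -!mulgA -zexpgD; congr (_ * (_ * (_ * zexpg _ _)))%g; ring.
Qed.

Lemma coset_action1 f : coset_action 1%g f = f.
Proof. by rewrite /coset_action mul1g kernel_part_val. Qed.

Lemma polynomial_coset_action (A : zmodType) c (phi : F -> A) g :
  polynomial_fun X c phi -> polynomial_fun X c (fun f => phi (coset_action g f)).
Proof.
move=> Pphi; rewrite (_ : (fun f => _) =
  fun f => phi (kernel_part g * ker_conj (zexpg t (height g)) f)%g); last first.
  by apply/funext => f; rewrite coset_actionE.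
apply: (@polynomial_endomorphism _ _ _ X_basis _ _ (fun f => phi (kernel_part g * f)%g)).
  exact: ker_conjM.
exact: polynomial_ltrans.
Qed.

(** Modulo [q], a polynomial function is moved by [G] within the finite set of all
    polynomial functions of its degree. *)
Lemma polynomial_finite_kernel c (phi : F -> int) (q : nat) :
  polynomial_fun X c phi -> phi 1%g = 0 -> (0 < q)%N ->
  exists2 K, finite_kernel K & forall z, height z = 0 -> K z ->
    (q%:Z %| phi (kernel_part z))%Z.
Proof.
move=> Pphi phi1 q0; pose p := q.*2.
pose act g (e : polynomial_code n 'Z_p c) : polynomial_code n 'Z_p c :=
  encode X c (fun f => decode X_basis e (coset_action g^-1%g f)).
have act1 e : act 1%g e = e.
  rewrite -[RHS](decodeK X_basis) /act invg1; congr encode.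
  by apply/funext => f; rewrite coset_action1.
have actM g h e : act (g * h)%g e = act g (act h e).
  rewrite /act encodeK; last exact/polynomial_coset_action/decode_polynomial.
  by congr encode; apply/funext => f; rewrite invgM coset_actionM.
exists (fun g => forall e, act g e = e); first exact: finite_kernel_action.
move=> z z0 zK; pose phi_p f : 'Z_p := (phi f)%:~R.
have Pphi_p : polynomial_fun X c phi_p.
  by apply: (polynomial_additive (f := fun k : int => k%:~R : 'Z_p)) => // x y; rewrite mulrzBr.
have /(congr1 (@decode _ _ _ X_basis _ _)) := zK (encode X c phi_p).
rewrite /act !encodeK //; last exact: polynomial_coset_action.
move/(congr1 (fun psi => psi (kernel_part z))).
rewrite /coset_action val_kernel_part // mulVg -(val1 F) kernel_part_val /phi_p phi1.
by move/esym/(intr_Zp_double_eq0 q0).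
Qed.

End FiniteDetection.

Section Levels.
Variables (N M : nat).
Hypotheses (N0 : (0 < N)%N).

Local Notation al := (iter N (ker_conj t)).

Hypothesis unipotent : forall i, weighted_letter X_basis al (i, M) = 0.

Definition height_multiple g : Prop := (N%:Z %| height g)%Z.

Lemma height_multiple_normalised : normalised_subgroup height_multiple height_multiple.
Proof.
rewrite /height_multiple; split=> [|x y xN yN|x|g z _].
- by rewrite height1 dvdz0.
- by rewrite heightM rpredD.
- by rewrite heightV rpredN.
- by rewrite !heightM heightV addrAC subrr add0r.
Qed.

Lemma height_finite_kernel (q : nat) : (0 < q)%N ->
  exists2 K, finite_kernel K & forall g, K g -> (q%:Z %| height g)%Z.
Proof.
move=> q0; pose p := q.*2.
pose act g (s : 'Z_p) : 'Z_p := (height g)%:~R + s.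
exists (fun g => forall s, act g s = s).
  apply: finite_kernel_action => [s|g h s]; rewrite /act ?height1 ?add0r //.
  by rewrite heightM rmorphD addrA.
by move=> g /(_ 0); rewrite /act addr0 => /(intr_Zp_double_eq0 q0).
Qed.

(** The filtration of the group of elements of height divisible by [N]: the kernel
    of the height comes first, then its dimension subgroups. *)
Definition level c g : Prop :=
  if c is c'.+1 then height g = 0 /\ dimension_subgroup X c (kernel_part g)
  else height_multiple g.

(** The step from [level c] to the next one is refined by decreasing weight, as [t ^+ N]
    acts trivially on the graded pieces of this refinement only. *)
Definition sublevel c m g : Prop :=
  [/\ height g = 0, dimension_subgroup X c (kernel_part g) &
      forall s, size s = c -> (m <= weight s)%N ->
        iterated_sum X_basis (weighted_letters X_basis al s) (kernel_part g) = 0].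

Lemma al_kernel_part z : height z = 0 ->
  kernel_part (t ^+ N * z * (t ^+ N)^-1)%g = al (kernel_part z).
Proof.
move=> z0; apply: val_inj; rewrite val_kernel_part; last first.
  by rewrite !heightM heightV z0 addr0 subrr.
have -> f : val (al f) = (t ^+ N * val f * (t ^+ N)^-1)%g.
  elim: N => [|k IH]; first by rewrite /= mul1g invg1 mulg1.
  by rewrite iterS /= IH !expgS !invgM !mulgA.
by rewrite val_kernel_part.
Qed.

(** The elements whose conjugation preserves the functional form a subgroup; it
    contains the kernel of the height by additivity on the dimension subgroup, and
    [t ^+ N] since the correction terms have larger weight. *)
Lemma sublevel_functional c m s :
  normalised_subgroup height_multiple (sublevel c.+1 m.+1) ->
  size s = c.+1 -> (m <= weight s)%N ->
  central_functional height_multiple (sublevel c.+1 m.+1)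
    (fun g => iterated_sum X_basis (weighted_letters X_basis al s) (kernel_part g)).
Proof.
move=> nS sz wt; set e := iterated_sum _ _.
have sz' : size (weighted_letters X_basis al s) = c.+1 by rewrite size_map.
have Pe : polynomial_fun X c.+2 e by rewrite -sz'; apply: iterated_sum_polynomial.
have e1 : e 1%g = 0.
  by rewrite /e; case: (weighted_letters _ _ s) sz' => // h l _; apply: iterated_sum1.
split=> [x y [x0 dim_x _] [y0 _ _]|g z Gg Sz|q q0].
- by rewrite kernel_partM // (homogeneousMr X_basis Pe e1).
- pose inv g := height_multiple g /\ forall z, sublevel c.+1 m.+1 z ->
    e (kernel_part (g * z * g^-1)%g) = e (kernel_part z).
  have invM g' h : inv g' -> inv h -> inv (g' * h)%g.
    move=> [Gg' ig'] [Gh ih]; split; first exact: (normalisedM height_multiple_normalised).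
    move=> z' Sz'; rewrite invgM !mulgA.
    have -> : (g' * h * z' * h^-1 * g'^-1 = g' * (h * z' * h^-1) * g'^-1)%g.
      by rewrite !mulgA.
    by rewrite ig' ?ih //; apply: (normalisedJ nS).
  have invV g' : inv g' -> inv g'^-1%g.
    move=> [Gg' ig']; have Gg'V := normalisedV height_multiple_normalised Gg'.
    split=> // z' Sz'; rewrite invgK -[RHS](congr1 (fun x => e (kernel_part x))
      (_ : g' * (g'^-1 * z' * g') * g'^-1 = z')%g).
      rewrite ig' //; have := normalisedJ nS Gg'V Sz'.
      by rewrite invgK.
    by rewrite !mulgA mulgV mul1g mulgK.
  have invF (f : F) : inv (val f).
    split=> [|z' [z'0 dim_z' _]]; first by rewrite /height_multiple height_kernel dvdz0.
    have f0 := height_kernel f; have fV0 : height (val f)^-1%g = 0 by rewrite heightV f0 oppr0.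
    rewrite !kernel_partM ?heightM ?f0 ?z'0 //.
    have -> : kernel_part (val f)^-1%g = (kernel_part (val f))^-1%g.
      apply: (mulgI (kernel_part (val f))); rewrite -kernel_partM // !mulgV.
      by apply: val_inj; rewrite val_kernel_part ?height1.
    exact: (homogeneousJ X_basis Pe e1).
  have inv_tN : inv (t ^+ N)%g.
    have htN : height (t ^+ N)%g = N%:Z := height_zexpg N%:Z.
    split=> [|z' [z'0 dim_z' wt_z']]; first by rewrite /height_multiple htN.
    have alM : {morph al : x y / (x * y)%g} := morph_iter N (ker_conjM t).
    rewrite al_kernel_part // /e (iterated_sum_endomorphism_homogeneous X_basis alM) ?sz' //.
      exact: (iterated_sum_pullback_weighted (c := c.+1) (m := m)).
    by rewrite -size_eq0 sz'.
  have inv1 : inv 1%g by rewrite -(val1 F); apply: invF.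
  have invX k : inv ((t ^+ N) ^+ k)%g.
    by elim: k => [|k IH]; rewrite ?expg0 // expgS; apply: invM.
  have invZ k : inv (zexpg (t ^+ N)%g k).
    by case: k => k; rewrite /zexpg; [|apply: invV]; apply: invX.
  suff [_] : inv g by apply.
  have /dvdzP[k gk] := Gg; rewrite [g]kernel_partE; apply: invM => //.
  by rewrite gk mulrC -zexpgXn.
- have [K fK Ke] := polynomial_finite_kernel Pe e1 q0.
  by exists K => // z [z0 _ _]; apply: Ke.
Qed.

Lemma sublevel_top c : sublevel c.+1 (c.+1 * M) = level c.+1.
Proof.
apply/funext => g; apply/propext; split=> [[]//|[g0 dim_g]]; split=> // s sz wt.
apply: (iterated_sum_weighted0 unipotent); apply/negP => /weight_lt.
by rewrite -size_eq0 sz => /(_ isT); rewrite ltnNge wt.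
Qed.

Lemma sublevel_bottom c : sublevel c.+1 0 = level c.+2.
Proof.
apply/funext => g; apply/propext; split=> [[g0 dim_g coef0]|[g0 dim_g]].
  split=> //; apply: (dimension_subgroupS (X_basis := X_basis) dim_g) => I sI.
  have := coef0 (map (fun i => (i, 0%N)) I); rewrite size_map => /(_ sI isT).
  rewrite /weighted_letters -map_comp /coefficient => ->.
  by case: I sI => // i I _; rewrite /= -/(iterated_sum _ (_ :: _)) iterated_sum1.
split=> //; first exact: dimension_subgroup_leq dim_g.
move=> s sz _; have := iterated_sum_polynomial X_basis (weighted_letters X_basis al s).
rewrite size_map sz => /dim_g ->.
by case: s sz => // p s _; apply: iterated_sum1.
Qed.

Lemma level_chain c : central_chain height_multiple height_multiple (level c).
Proof.
have nG := height_multiple_normalised.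
case: c => [|c]; first exact: CentralChain0.
elim: c => [|c IH].
  have ch : central_functional height_multiple height_multiple height.
    split=> [x y _ _|g z _ _|q q0]; first exact: heightM.
      by rewrite !heightM heightV addrAC subrr add0r.
    by have [K fK Ke] := height_finite_kernel q0; exists K => // z _; apply: Ke.
  have := CentralChainS (CentralChain0 _ _) ch; congr central_chain.
  apply/funext => g; apply/propext; split=> [[_ g0]|[g0 _]].
    by split=> //; apply: dimension_subgroup1.
  by rewrite /height_multiple g0 dvdz0.
rewrite -sublevel_bottom -sublevel_top in IH *; rewrite -(subnn (c.+1 * M)%N).
have [k kE] : exists k, k = (c.+1 * M)%N by eexists.
suff: forall j, (j <= k)%N -> central_chain height_multiple height_multiple
    (sublevel c.+1 (k - j)) by rewrite -kE => /(_ k (leqnn k)).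
elim=> [_|j IHj jk]; first by rewrite subn0 kE.
have := IHj (ltnW jk); rewrite -{1}(subnSK jk); set m := (k - j.+1)%N => chain.
have nS := central_chain_normalised nG chain.
(* Letters of weight [M] or more vanish, so finitely many functionals suffice. *)
pose val_s (s : c.+1.-tuple ('I_n * 'I_M)) := [seq (p.1, val p.2) | p <- s].
have size_val_s s : size (val_s s) = c.+1 by rewrite size_map size_tuple.
pose ss := [seq s <- enum {: c.+1.-tuple ('I_n * 'I_M)} | m <= weight (val_s s)]%N.
pose e s g := iterated_sum X_basis (weighted_letters X_basis al (val_s s)) (kernel_part g).
have ce s : s \in ss -> central_functional height_multiple (sublevel c.+1 m.+1) (e s).
  by rewrite mem_filter => /andP[wt _]; apply: sublevel_functional.
have := central_chain_trans chain (central_chain_seq ce); congr central_chain.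
apply/funext => g; apply/propext; split=> [[[g0 dim_g _] eg]|[g0 dim_g wg]]; last first.
  split=> [|s]; first by split=> // s sz /ltnW; apply: wg.
  by rewrite mem_filter => /andP[wt _]; apply: wg.
split=> // s sz wt.
have [sM|] := boolP (all (fun p => p.2 < M)%N s); last exact: (iterated_sum_weighted0 unipotent).
have [s' s'E] : exists s', val_s s' = s.
  have M0 : (0 < M)%N by case: s sz sM {wt} => // p s _ /= /andP[/(leq_ltn_trans (leq0n _))].
  pose s' := [seq (p.1, insubd (Ordinal M0) p.2) | p <- s].
  have sz' : size s' == c.+1 by rewrite size_map sz.
  exists (Tuple sz'); rewrite /val_s /= -map_comp -[RHS]map_id; apply/eq_in_map.
  by move=> -[i j'] /(allP sM) /= jM; rewrite val_insubd jM.
have := eg s'; rewrite mem_filter s'E wt mem_enum => /(_ isT).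
by rewrite /e s'E.
Qed.

Lemma level_leq c d g : (c <= d)%N -> level d g -> level c g.
Proof.
case: c d => [|c] [|d] // cd [g0 dim_g]; first by rewrite /= /height_multiple g0 dvdz0.
by split=> //; apply: dimension_subgroup_leq dim_g.
Qed.

Lemma levels_separated g : (forall c, level c g) -> g = 1%g.
Proof.
move=> lg; have [g0 _] := lg 1%N; rewrite -(val_kernel_part g0).
rewrite (_ : kernel_part g = 1%g) ?val1 //; apply: (dimension_subgroups_separated X_basis).
by move=> c; have [_] := lg c.+1; apply: dimension_subgroup_leq.
Qed.

Lemma unipotent_two_sided_separated a b x :
  (forall m n, two_sided a b x m n <> 1%g) ->
  exists2 K : G -> Prop, finite_kernel K & forall m n, ~ K (two_sided a b x m n).
Proof.
have [K0 fK0 K0N] := height_finite_kernel N0.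
exact: (two_sided_separated height_multiple_normalised level_chain level_leq
  levels_separated fK0 K0N).
Qed.

End Levels.
End FreeByCyclic.

Theorem theorem3 (G : groupType)
    (G_fbc : fg_free_by_cyclic_with polynomially_growing G)
    (H K : set G) (H_cyclic : cyclic_subgroup H) (K_cyclic : cyclic_subgroup K)
    (g : G) :
  separable (double_coset H g K).
Proof.
have [chi [_ _ [phi [t chi_t <-] [n [X [X_basis [d growth]]]]]]] := G_fbc.
have conjK : cancel (ker_conj t^-1%g) (ker_conj t : kernel chi -> kernel chi).
  by move=> f; apply: val_inj; rewrite /= invgK !mulgA mulgV mul1g mulgK.
have [N [M [N0 unipotent]]] :=
  polynomial_growth_unipotent X_basis (ker_conjM t) (ker_conjM _) conjK growth.
apply: separable_double_coset => // a b x.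
exact: (unipotent_two_sided_separated chi_t N0 unipotent).
Qed.
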